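(* Consider the scheme $$\bar{\mathbf u}_{ij}^{n+1}=\bar{\mathbf u}_{ij}^n-\sigma_1\big(\hat{\mathbf f}_{1,i+\frac12,j}-\hat{\mathbf f}_{1,i-\frac12,j}\big)-\sigma_2\big(\hat{\mathbf f}_{2,i,j+\frac12}-\hat{\mathbf f}_{2,i,j-\frac12}\big)-\widehat{\mathbf S}_{ij}$$ for the 2D multicomponent MHD system, with $\sigma_1=\Delta t/\Delta x$, $\sigma_2=\Delta t/\Delta y$ and with the numerical fluxes $\hat{\mathbf f}_1,\hat{\mathbf f}_2$, the discrete source term $\widehat{\mathbf S}_{ij}$, the polynomials $\mathbf U_{ij}^n$ of degree $K\ge 1$, the quadrature points and weights, the parameters $\alpha_{\ell,n}$, $\varepsilon$, $\lambda=\sigma_1\alpha_{1,n}+\sigma_2\alpha_{2,n}$ and the sets $G$, $G_*$ as defined in the context. If for all $i$ and $j$, $\bar{\mathbf u}_{ij}^n\in G$ and the polynomial vector $\mathbf U_{ij}^n(x,y)$ satisfies $$\mathbf U_{ij}^n(\widehat x_i^{(\beta)},y_j^{(q)})\in G,\qquad \mathbf U_{ij}^n(x_i^{(q)},\widehat y_j^{(\beta)})\in G\qquad\forall\,\beta,q,$$ and $\mathrm{div}_{ij}^{-}\mathbf B=0$, then, under the CFL condition $$(1+\varepsilon)\lambda\le\widehat\omega_1,$$ the solution $\bar{\mathbf u}_{ij}^{n+1}$ of the scheme is always preserved in $G_*$, i.e. $\bar{\mathbf u}_{ij}^{n+1}\in G_*$ for all $i,j$.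
   Context: **System and regions.** Multicomponent MHD with $n_c$ components: $\mathbf u=(\rho\mathbf Y,\rho,\boldsymbol m,\mathbf B,E)^\top\in\mathbb R^{n_c+7}$, $\mathbf Y=(Y_1,\dots,Y_{n_c-1})^\top$ mass fractions, $Y_{n_c}:=1-\sum_{k=1}^{n_c-1}Y_k$, $\boldsymbol m=\rho\boldsymbol v\in\mathbb R^3$, $\mathbf B\in\mathbb R^3$. For $\ell=1,2$, $$\mathbf f_\ell(\mathbf u)=\big(\rho\mathbf Y v_\ell,\ \rho v_\ell,\ \boldsymbol m v_\ell-\mathbf B B_\ell+p_{tot}\mathbf i_\ell,\ \mathbf B v_\ell-\boldsymbol vB_\ell,\ v_\ell(E+p_{tot})-B_\ell(\boldsymbol v\cdot\mathbf B)\big)^\top,$$ where $\mathbf i_\ell$ is the $\ell$-th standard unit vector of $\mathbb R^3$, $p_{tot}=p+\frac12\|\mathbf B\|^2$, $$p=(\Gamma(\mathbf u)-1)\Big(E-\frac{\|\boldsymbol m\|^2}{2\rho}-\frac{\|\mathbf B\|^2}{2}\Big),\quad \Gamma(\mathbf u)=\frac{\sum_{k=1}^{n_c}\Gamma_kC_{v_k}Y_k}{\sum_{k=1}^{n_c}C_{v_k}Y_k},\quad C_{v_k}>0,\ \Gamma_k>1.$$ The invariant region is $G=\{\mathbf u:\ 0\le Y_k\le 1,\ 1\le k\le n_c,\ \rho>0,\ p(\mathbf u)>0\}$, and $$G_*=\{\mathbf u:\ \mathbf u\cdot\mathbf e_k\ge 0,\ 0\le k<n_c,\ \ \mathbf u\cdot\mathbf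 e_{n_c}>0,\ \ \varphi(\mathbf u;\boldsymbol v_*,\mathbf B_* )>0\ \ \forall\,\boldsymbol v_*,\mathbf B_*\in\mathbb R^3\}$$ is its equivalent linear representation ($G_*=G$), where $\mathbf e_k$ ($k\ge1$) is the $k$-th standard unit vector of $\mathbb R^{n_c+7}$, $\mathbf e_0:=\mathbf e_{n_c}-\sum_{k=1}^{n_c-1}\mathbf e_k$, $\varphi(\mathbf u;\boldsymbol v_*,\mathbf B_* ):=\mathbf u\cdot\mathbf n_*+\frac12\|\mathbf B_*\|^2$, $\mathbf n_*=(\mathbf 0_{n_c-1},\frac12\|\boldsymbol v_*\|^2,-\boldsymbol v_*,-\mathbf B_*,1)^\top$. **Mesh, polynomials, quadrature.** Uniform Cartesian cells $\mathcal I_{ij}=[x_{i-1/2},x_{i+1/2}]\times[y_{j-1/2},y_{j+1/2}]$ of sizes $\Delta x,\Delta y$; $\Delta t>0$ is the time step. $\mathbf U_{ij}^n(x,y)$ is a vector of polynomials of degree $K$ on $\mathcal I_{ij}$ (finite volume reconstruction or discontinuous Galerkin solution) with cell average $\bar{\mathbf u}_{ij}^n$. $\{\omega_q,x_i^{(q)}\}_{q=1}^Q$ and $\{\omega_q,y_j^{(q)}\}_{q=1}^Q$ are the Gauss quadrature weights and nodes in $[x_{i-1/2},x_{i+1/2}]$ and $[y_{j-1/2},y_{j+1/2}]$ (weights normalized to sum to 1), with $Q$ large enough that the rule is exact for polynomials of degree $K$. $\{\widehat x_i^{(\beta)}\}_{\beta=1}^L$, $\{\widehat y_j^{(\beta)}\}_{\beta=1}^L$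 are the Gauss–Lobatto points in the same intervals with normalized weights $\{\widehat\omega_\beta\}_{\beta=1}^L$, $L=\lceil\frac{K+3}2\rceil$ ($\widehat\omega_1$ is the weight of an endpoint). Traces: $\mathbf u^{\pm,q}_{i\mp\frac12,j}=\mathbf U_{ij}^n(x_{i\mp\frac12},y_j^{(q)})$, $\mathbf u^{q,\pm}_{i,j\mp\frac12}=\mathbf U_{ij}^n(x_i^{(q)},y_{j\mp\frac12})$; components (e.g. $B_1,\rho$) of these traces carry the same indices. **Fluxes.** $\hat{\mathbf f}_{1,i+\frac12,j}=\sum_q\omega_q\hat{\mathbf f}_1^{\rm LF}(\mathbf u^{-,q}_{i+\frac12,j},\mathbf u^{+,q}_{i+\frac12,j})$, $\hat{\mathbf f}_{2,i,j+\frac12}=\sum_q\omega_q\hat{\mathbf f}_2^{\rm LF}(\mathbf u^{q,-}_{i,j+\frac12},\mathbf u^{q,+}_{i,j+\frac12})$, with $\hat{\mathbf f}_\ell^{\rm LF}(\mathbf u^L,\mathbf u^R)=\frac12\big(\mathbf f_\ell(\mathbf u^L)+\mathbf f_\ell(\mathbf u^R)-\alpha_{\ell,n}(\mathbf u^R-\mathbf u^L)\big)$ and $$\alpha_{1,n}\ge\max_{i,j,q}\widehat\alpha_1\big(\mathbf u^{\mp,q}_{i+\frac12,j},\mathbf u^{\pm,q}_{i-\frac12,j}\big),\qquad \alpha_{2,n}\ge\max_{i,j,q}\widehat\alpha_2\big(\mathbf u^{q,\mp}_{i,j+\frac12},\mathbf u^{q,\pm}_{i,j-\frac12}\big)$$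 (for both choices of signs), where $$\widehat\alpha_\ell(\mathbf u,\tilde{\mathbf u})=\max\Big\{|v_\ell|+\mathcal C_\ell,\ |\tilde v_\ell|+\tilde{\mathcal C}_\ell,\ \frac{|\sqrt\rho\,v_\ell+\sqrt{\tilde\rho}\,\tilde v_\ell|}{\sqrt\rho+\sqrt{\tilde\rho}}+\max\{\mathcal C_\ell,\tilde{\mathcal C}_\ell\}\Big\}+\frac{\|\mathbf B-\tilde{\mathbf B}\|}{\sqrt\rho+\sqrt{\tilde\rho}},$$ and $\mathcal C_\ell$ is the fast magneto-acoustic speed in direction $\ell$: $\mathcal C_\ell=\frac1{\sqrt2}\big[a^2+\frac{\|\mathbf B\|^2}{\rho}+\big((a^2+\frac{\|\mathbf B\|^2}{\rho})^2-\frac{4a^2B_\ell^2}{\rho}\big)^{1/2}\big]^{1/2}$, $a^2=\Gamma(\mathbf u)p/\rho$. **Discrete divergence, jumps, source.** $$\mathrm{div}_{ij}^{-}\mathbf B:=\frac1{\Delta x}\sum_{q=1}^Q\omega_q\big(B^{-,q}_{1,i+\frac12,j}-B^{+,q}_{1,i-\frac12,j}\big)+\frac1{\Delta y}\sum_{q=1}^Q\omega_q\big(B^{q,-}_{2,i,j+\frac12}-B^{q,+}_{2,i,j-\frac12}\big).$$ Jumps: $[\![B_1]\!]^q_{i+\frac12,j}=B^{+,q}_{1,i+\frac12,j}-B^{-,q}_{1,i+\frac12,j}$, $[\![B_2]\!]^q_{i,j+\frac12}=B^{q,+}_{2,i,j+\frac12}-B^{q,-}_{2,i,j+\frac12}$.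 With $\mathbf S(\mathbf u)=(\mathbf 0_{n_c},\mathbf B,\boldsymbol v,\boldsymbol v\cdot\mathbf B)^\top$, $$\widehat{\mathbf S}_{ij}=\frac{\sigma_1}2\sum_{q=1}^Q\omega_q\Big([\![B_1]\!]^q_{i+\frac12,j}\mathbf S(\mathbf u^{-,q}_{i+\frac12,j})+[\![B_1]\!]^q_{i-\frac12,j}\mathbf S(\mathbf u^{+,q}_{i-\frac12,j})\Big)+\frac{\sigma_2}2\sum_{q=1}^Q\omega_q\Big([\![B_2]\!]^q_{i,j+\frac12}\mathbf S(\mathbf u^{q,-}_{i,j+\frac12})+[\![B_2]\!]^q_{i,j-\frac12}\mathbf S(\mathbf u^{q,+}_{i,j-\frac12})\Big).$$ Finally $\varepsilon=\max\{\beta_1/\alpha_{1,n},\beta_2/\alpha_{2,n}\}$ with $$\beta_1=\max_{i,j,q}\Big\{\big|[\![B_1]\!]^q_{i+\frac12,j}\big|\,(\rho^{\pm,q}_{i+\frac12,j})^{-1/2}\Big\},\qquad \beta_2=\max_{i,j,q}\Big\{\big|[\![B_2]\!]^q_{i,j+\frac12}\big|\,(\rho^{q,\pm}_{i,j+\frac12})^{-1/2}\Big\}$$ (maximum over both signs). *)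

(* Defs.v *)
From HB Require Import structures.
From mathcomp Require Import all_boot all_order all_algebra polyXY.
From mathcomp Require Import all_classical all_reals all_analysis.
Set Implicit Arguments.
Unset Strict Implicit.
Unset Printing Implicit Defensive.
Import Order.TTheory GRing.Theory Num.Theory.
Import numFieldNormedType.Exports.
Local Open Scope classical_set_scope.
Local Open Scope ring_scope.

(* The canonical norm `|_| on row vectors is the sup norm, hence the Euclidean
   structure is introduced here. *)
Definition dotv (R : realType) (d : nat) (u w : 'rV[R]_d) : R :=
  \sum_i u ord0 i * w ord0 i.
Definition sqnorm (R : realType) (d : nat) (u : 'rV[R]_d) : R := dotv u u.
Definition enorm (R : realType) (d : nat) (u : 'rV[R]_d) : R :=
  Num.sqrt (sqnorm u).

(* There are n.+1 components (n_c = n.+1), n of whose mass fractions are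
   evolved.  A state is the block row (rho Y, rho, m, B, E), of size
   n + 8 = n_c + 7. *)
Definition sdim (n : nat) : nat := (n + (1 + (3 + (3 + 1))))%N.
Notation state R n := ('rV[R]_(sdim n)).

Definition mk_state (R : realType) (n : nat) (rY : 'rV[R]_n) (r : R)
    (m B : 'rV[R]_3) (E : R) : state R n :=
  row_mx rY (row_mx r%:M (row_mx m (row_mx B E%:M))).

Definition mass_frac_part (R : realType) (n : nat) (u : state R n) : 'rV[R]_n :=
  lsubmx u.
Definition rho (R : realType) (n : nat) (u : state R n) : R :=
  (lsubmx (rsubmx u)) ord0 ord0.
Definition mom (R : realType) (n : nat) (u : state R n) : 'rV[R]_3 :=
  lsubmx (rsubmx (rsubmx u)).
Definition mag (R : realType) (n : nat) (u : state R n) : 'rV[R]_3 :=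
  lsubmx (rsubmx (rsubmx (rsubmx u))).
Definition energy (R : realType) (n : nat) (u : state R n) : R :=
  (rsubmx (rsubmx (rsubmx (rsubmx u)))) ord0 ord0.
Definition vel (R : realType) (n : nat) (u : state R n) : 'rV[R]_3 :=
  (rho u)^-1 *: mom u.

(* Y_1, ..., Y_{n_c - 1} are the entries k < n; the entry k = n is
   Y_{n_c} = 1 - sum of the others. *)
Definition Y (R : realType) (n : nat) (u : state R n) (k : 'I_n.+1) : R :=
  if insub (val k) is Some k' then mass_frac_part u ord0 k' / rho u
  else 1 - \sum_(k' < n) mass_frac_part u ord0 k' / rho u.

Record mixture (R : realType) (n : nat) :=
  Mixture { adiab : 'I_n.+1 -> R ; heat_cap : 'I_n.+1 -> R }.

Definition Gam (R : realType) (n : nat) (mix : mixture R n) (u : state R n) : R :=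
  (\sum_k adiab mix k * heat_cap mix k * Y u k) /
  (\sum_k heat_cap mix k * Y u k).

Definition pressure (R : realType) (n : nat) (mix : mixture R n)
    (u : state R n) : R :=
  (Gam mix u - 1) *
  (energy u - sqnorm (mom u) / (2 * rho u) - sqnorm (mag u) / 2).

Definition ptot (R : realType) (n : nat) (mix : mixture R n) (u : state R n) : R :=
  pressure mix u + sqnorm (mag u) / 2.

(* The two space directions l = 1, 2, as indices of components in R^3. *)
Definition dir1 : 'I_3 := @Ordinal 3 0 isT.
Definition dir2 : 'I_3 := @Ordinal 3 1 isT.

Definition flux (R : realType) (n : nat) (mix : mixture R n) (l : 'I_3)
    (u : state R n) : state R n :=
  let v := vel u in let B := mag u in
  let vl := v ord0 l in let Bl := B ord0 l in
  mk_state (vl *: mass_frac_part u)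
           (rho u * vl)
           (vl *: mom u - Bl *: B + ptot mix u *: delta_mx ord0 l)
           (vl *: B - Bl *: v)
           (vl * (energy u + ptot mix u) - Bl * dotv v B).

Definition source (R : realType) (n : nat) (u : state R n) : state R n :=
  mk_state 0 0 (mag u) (vel u) (dotv (vel u) (mag u)).

Definition G (R : realType) (n : nat) (mix : mixture R n) : set (state R n) :=
  [set u | (forall k, 0 <= Y u k <= 1) /\ 0 < rho u /\ 0 < pressure mix u].

(* Standard unit vectors: evec k is e_{k+1} for k < n, and evec_rho is
   e_{n_c}. *)
Definition evec (R : realType) (n : nat) (k : 'I_n) : state R n :=
  mk_state (delta_mx ord0 k) 0 0 0 0.
Definition evec_rho (R : realType) (n : nat) : state R n := mk_state 0 1 0 0 0.
Definition evec0 (R : realType) (n : nat) : state R n :=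
  evec_rho R n - \sum_(k < n) evec R k.

Definition nstar (R : realType) (n : nat) (vs Bs : 'rV[R]_3) : state R n :=
  mk_state 0 (sqnorm vs / 2) (- vs) (- Bs) 1.

Definition phi (R : realType) (n : nat) (u : state R n) (vs Bs : 'rV[R]_3) : R :=
  dotv u (nstar n vs Bs) + sqnorm Bs / 2.

Definition Gstar (R : realType) (n : nat) : set (state R n) :=
  [set u | [/\ 0 <= dotv u (evec0 R n),
               forall k : 'I_n, 0 <= dotv u (evec R k),
               0 < dotv u (evec_rho R n) &
               forall vs Bs : 'rV[R]_3, 0 < phi u vs Bs]].

Definition sound2 (R : realType) (n : nat) (mix : mixture R n) (u : state R n) : R :=
  Gam mix u * pressure mix u / rho u.

Definition fast_speed (R : realType) (n : nat) (mix : mixture R n) (l : 'I_3)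
    (u : state R n) : R :=
  let a2 := sound2 mix u in
  let s := a2 + sqnorm (mag u) / rho u in
  (Num.sqrt 2)^-1 *
  Num.sqrt (s + Num.sqrt (s ^+ 2 - 4 * a2 * (mag u ord0 l) ^+ 2 / rho u)).

Definition alpha_hat (R : realType) (n : nat) (mix : mixture R n) (l : 'I_3)
    (u w : state R n) : R :=
  let C := fast_speed mix l u in let C' := fast_speed mix l w in
  let vl := vel u ord0 l in let vl' := vel w ord0 l in
  let r := Num.sqrt (rho u) in let r' := Num.sqrt (rho w) in
  Num.max (`|vl| + C)
    (Num.max (`|vl'| + C') (`|r * vl + r' * vl'| / (r + r') + Num.max C C'))
  + enorm (mag u - mag w) / (r + r').

Definition flux_LF (R : realType) (n : nat) (mix : mixture R n) (l : 'I_3)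
    (alpha : R) (uL uR : state R n) : state R n :=
  2^-1 *: (flux mix l uL + flux mix l uR - alpha *: (uR - uL)).

(* Quadrature rules on the reference interval [-1, 1], with weights normalized
   to sum to 1, i.e. approximating the mean value. *)
Record quad_rule (R : realType) (N : nat) :=
  QuadRule { node : 'I_N -> R ; weight : 'I_N -> R }.

Definition quad_exact (R : realType) (N : nat) (r : quad_rule R N) (d : nat) :=
  forall p : {poly R}, (size p <= d.+1)%N ->
    \sum_(q < N) weight r q * p.[node r q] =
    (\int[@lebesgue_measure R]_(t in `[(-1 : R), 1]) p.[t]) / 2.

(* The N-point Gauss rule: N distinct nodes in the interval, with the maximal
   degree of exactness 2N-1. *)
Definition is_gauss (R : realType) (N : nat) (r : quad_rule R N) : Prop :=
  [/\ (0 < N)%N, injective (node r), forall q, -1 <= node r q <= 1 &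
      quad_exact r (2 * N).-1%N].

(* The L-point Gauss-Lobatto rule, L = N.+2: distinct nodes including both
   endpoints (the first and the last one), with the maximal degree of exactness
   2L-3. *)
Definition is_gauss_lobatto (R : realType) (N : nat) (r : quad_rule R N.+2) :
    Prop :=
  [/\ injective (node r), forall b, -1 <= node r b <= 1,
      node r ord0 = -1, node r ord_max = 1 & quad_exact r (2 * N.+2 - 3)%N].

(* Cell (i, j) of the uniform mesh is
   [x_{i-1/2}, x_{i+1/2}] x [y_{j-1/2}, y_{j+1/2}]; the index i of [xface]
   stands for x_{i+1/2}. *)
Record mesh (R : realType) := Mesh { xorig : R ; yorig : R ; dx : R ; dy : R }.

Definition xface (R : realType) (M : mesh R) (i : int) : R :=
  xorig M + (i + 1)%:~R * dx M.
Definition yface (R : realType) (M : mesh R) (j : int) : R :=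
  yorig M + (j + 1)%:~R * dy M.

(* Affine images in cell number i (resp. j) of a reference node t in [-1, 1]. *)
Definition xpt (R : realType) (M : mesh R) (i : int) (t : R) : R :=
  xface M (i - 1) + dx M * ((1 + t) / 2).
Definition ypt (R : realType) (M : mesh R) (j : int) (t : R) : R :=
  yface M (j - 1) + dy M * ((1 + t) / 2).

Definition cell (R : realType) (M : mesh R) (i j : int) : set (R * R) :=
  `[xface M (i - 1), xface M i] `*` `[yface M (j - 1), yface M j].

(* Vectors of bivariate polynomials; p.[x, y] evaluates the outer
   indeterminate of {poly {poly R}} at x and the inner one at y. *)
Notation poly_state R n := ('rV[{poly {poly R}}]_(sdim n)).

Definition eval_state (R : realType) (n : nat) (U : poly_state R n) (x y : R) :
    state R n := map_mx (fun p : {poly {poly R}} => p.[x, y]) U.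

(* Total degree at most K. *)
Definition degree_le (R : realType) (K : nat) (p : {poly {poly R}}) : Prop :=
  forall a b : nat, p`_a`_b != 0 -> (a + b <= K)%N.

Definition cell_average (R : realType) (n : nat) (M : mesh R) (i j : int)
    (U : poly_state R n) : state R n :=
  map_mx (fun p : {poly {poly R}} =>
    (\int[(@lebesgue_measure R \x @lebesgue_measure R)%E]_(z in cell M i j)
        p.[z.1, z.2]) / (dx M * dy M)) U.

Definition solution (R : realType) (n : nat) : Type := int -> int -> poly_state R n.

(* Traces at the Gauss points of the faces: trace1m i j q and trace1p i j q are
   u^{-,q}_{i+1/2,j} and u^{+,q}_{i+1/2,j}; trace2m i j q and trace2p i j q are
   u^{q,-}_{i,j+1/2} and u^{q,+}_{i,j+1/2}. *)
Definition trace1m (R : realType) (n : nat) (M : mesh R) (Q : nat)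
    (g : quad_rule R Q) (U : solution R n) (i j : int) (q : 'I_Q) : state R n :=
  eval_state (U i j) (xface M i) (ypt M j (node g q)).
Definition trace1p (R : realType) (n : nat) (M : mesh R) (Q : nat)
    (g : quad_rule R Q) (U : solution R n) (i j : int) (q : 'I_Q) : state R n :=
  eval_state (U (i + 1) j) (xface M i) (ypt M j (node g q)).
Definition trace2m (R : realType) (n : nat) (M : mesh R) (Q : nat)
    (g : quad_rule R Q) (U : solution R n) (i j : int) (q : 'I_Q) : state R n :=
  eval_state (U i j) (xpt M i (node g q)) (yface M j).
Definition trace2p (R : realType) (n : nat) (M : mesh R) (Q : nat)
    (g : quad_rule R Q) (U : solution R n) (i j : int) (q : 'I_Q) : state R n :=
  eval_state (U i (j + 1)) (xpt M i (node g q)) (yface M j).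

Definition num_flux1 (R : realType) (n : nat) (mix : mixture R n) (M : mesh R)
    (Q : nat) (g : quad_rule R Q) (alpha1 : R) (U : solution R n) (i j : int) :
    state R n :=
  \sum_(q < Q) weight g q *:
    flux_LF mix dir1 alpha1 (trace1m M g U i j q) (trace1p M g U i j q).
Definition num_flux2 (R : realType) (n : nat) (mix : mixture R n) (M : mesh R)
    (Q : nat) (g : quad_rule R Q) (alpha2 : R) (U : solution R n) (i j : int) :
    state R n :=
  \sum_(q < Q) weight g q *:
    flux_LF mix dir2 alpha2 (trace2m M g U i j q) (trace2p M g U i j q).

Definition B_comp (R : realType) (n : nat) (l : 'I_3) (u : state R n) : R :=
  mag u ord0 l.

Definition jump1 (R : realType) (n : nat) (M : mesh R) (Q : nat)
    (g : quad_rule R Q) (U : solution R n) (i j : int) (q : 'I_Q) : R :=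
  B_comp dir1 (trace1p M g U i j q) - B_comp dir1 (trace1m M g U i j q).
Definition jump2 (R : realType) (n : nat) (M : mesh R) (Q : nat)
    (g : quad_rule R Q) (U : solution R n) (i j : int) (q : 'I_Q) : R :=
  B_comp dir2 (trace2p M g U i j q) - B_comp dir2 (trace2m M g U i j q).

Definition num_source (R : realType) (n : nat) (M : mesh R) (Q : nat)
    (g : quad_rule R Q) (sigma1 sigma2 : R) (U : solution R n) (i j : int) :
    state R n :=
  (sigma1 / 2) *: (\sum_(q < Q) weight g q *:
     (jump1 M g U i j q *: source (trace1m M g U i j q) +
      jump1 M g U (i - 1) j q *: source (trace1p M g U (i - 1) j q))) +
  (sigma2 / 2) *: (\sum_(q < Q) weight g q *:
     (jump2 M g U i j q *: source (trace2m M g U i j q) +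
      jump2 M g U i (j - 1) q *: source (trace2p M g U i (j - 1) q))).

Definition div_minus (R : realType) (n : nat) (M : mesh R) (Q : nat)
    (g : quad_rule R Q) (U : solution R n) (i j : int) : R :=
  (dx M)^-1 * (\sum_(q < Q) weight g q *
     (B_comp dir1 (trace1m M g U i j q) -
      B_comp dir1 (trace1p M g U (i - 1) j q))) +
  (dy M)^-1 * (\sum_(q < Q) weight g q *
     (B_comp dir2 (trace2m M g U i j q) -
      B_comp dir2 (trace2p M g U i (j - 1) q))).

(* Lower bounds on the viscosity parameters alpha_{l,n}, for both choices of
   signs in the traces. *)
Definition alpha1_ok (R : realType) (n : nat) (mix : mixture R n) (M : mesh R)
    (Q : nat) (g : quad_rule R Q) (U : solution R n) (alpha1 : R) : Prop :=
  forall (i j : int) (q : 'I_Q),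
    alpha_hat mix dir1 (trace1m M g U i j q) (trace1p M g U (i - 1) j q)
      <= alpha1 /\
    alpha_hat mix dir1 (trace1p M g U i j q) (trace1m M g U (i - 1) j q)
      <= alpha1.
Definition alpha2_ok (R : realType) (n : nat) (mix : mixture R n) (M : mesh R)
    (Q : nat) (g : quad_rule R Q) (U : solution R n) (alpha2 : R) : Prop :=
  forall (i j : int) (q : 'I_Q),
    alpha_hat mix dir2 (trace2m M g U i j q) (trace2p M g U i (j - 1) q)
      <= alpha2 /\
    alpha_hat mix dir2 (trace2p M g U i j q) (trace2m M g U i (j - 1) q)
      <= alpha2.

(* The mesh is indexed by int * int, so the maxima over all i, j, q are
   suprema in the extended reals: they agree with the maxima whenever these are
   attained (e.g. for periodic data), and are +oo for unbounded data. *)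
Definition beta1 (R : realType) (n : nat) (M : mesh R) (Q : nat)
    (g : quad_rule R Q) (U : solution R n) : \bar R :=
  ereal_sup [set z | exists (i j : int) (q : 'I_Q), exists2 u,
    u = trace1m M g U i j q \/ u = trace1p M g U i j q &
    z = (`|jump1 M g U i j q| * (Num.sqrt (rho u))^-1)%:E].
Definition beta2 (R : realType) (n : nat) (M : mesh R) (Q : nat)
    (g : quad_rule R Q) (U : solution R n) : \bar R :=
  ereal_sup [set z | exists (i j : int) (q : 'I_Q), exists2 u,
    u = trace2m M g U i j q \/ u = trace2p M g U i j q &
    z = (`|jump2 M g U i j q| * (Num.sqrt (rho u))^-1)%:E].

Definition epsilon (R : realType) (n : nat) (M : mesh R) (Q : nat)
    (g : quad_rule R Q) (U : solution R n) (alpha1 alpha2 : R) : \bar R :=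
  Order.max (beta1 M g U * (alpha1^-1)%:E)%E (beta2 M g U * (alpha2^-1)%:E)%E.

Definition scheme_step (R : realType) (n : nat) (mix : mixture R n) (M : mesh R)
    (Q : nat) (g : quad_rule R Q) (alpha1 alpha2 dt : R) (U : solution R n)
    (i j : int) : state R n :=
  let sigma1 := dt / dx M in let sigma2 := dt / dy M in
  cell_average M i j (U i j)
  - sigma1 *: (num_flux1 mix M g alpha1 U i j - num_flux1 mix M g alpha1 U (i - 1) j)
  - sigma2 *: (num_flux2 mix M g alpha2 U i j - num_flux2 mix M g alpha2 U i (j - 1))
  - num_source M g sigma1 sigma2 U i j.

(* Main.v *)
Require Import Defs.
From mathcomp Require Import all_boot all_order all_algebra polyXY.
From mathcomp Require Import all_classical all_reals all_analysis.
From mathcomp Require Import ring lra zify.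
Import Order.TTheory GRing.Theory Num.Theory.
Import numFieldNormedType.Exports.
Local Open Scope classical_set_scope.
Local Open Scope ring_scope.

(** Membership in [Gstar] means that affine functionals psi(u) = u . e + c of the
    state are positive (nonnegative for the partial densities), so each of them is
    followed separately through one step of the scheme.

    - The cell average is a convex combination of point values: the tensor product
      of the Gauss and Gauss-Lobatto rules integrates U exactly
      ([cell_average_quad]), the weights are nonnegative, and the two endpoint
      weights of the Gauss-Lobatto rule agree ([gauss_lobatto_symm]).  Hence
      psi(average) is at least the endpoint weight times the sums of psi over the
      inner traces of two opposite faces ([average_ge1], [average_ge2]).
    - The numerical fluxes of two opposite faces are regrouped into two pairs of
      states, one trace on each face, at the price of inner traces that the average
      absorbs under the CFL condition ([direction_bound], [cfl_absorb]).
    - For the functional phi( . ; v_star, B_star), each pair contributes a positive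
      amount as soon as the viscosity is at least [alpha_hat], up to a multiple of
      (v_star . B_star) times a difference of normal magnetic components
      ([flux_pair_gt0]).  One state alone does not suffice: its flux contains
      v_star_l |B - B_star|^2 / 2, which phi does not control, and only the
      difference of two such terms is quadratic in the deviations.
    - The leftover differences of normal components split into the discrete
      divergence, which vanishes, and the jumps at the faces.  The discrete source
      is such that the jump terms become (v - v_star) . (B - B_star), which is
      bounded by phi / sqrt rho ([source_le]); this is absorbed by the factor
      1 + epsilon in the CFL condition.
    - For the density and the partial densities the flux is the velocity times the
      functional and the source vanishes, so the same bound applies with simpler
      pairs ([scheme_step_advected_ge0], [scheme_step_advected_gt0]).

    Strictness survives equality in the CFL condition and in the lower bounds on
    the viscosities because the contribution of each pair is strictly positive:
    the pressure part of the flux is controlled by a proper fraction of the internal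
    energy ([bilin_le]). *)

Set Implicit Arguments.
Unset Strict Implicit.

(** * Polynomial quadrature on an interval *)

Lemma poly_antiderivative (R : realType) (p : {poly R}) : exists F : {poly R}, F^`() = p.
Proof.
(* At i = 0 the coefficient is a quotient by 0, which is 0. *)
exists (\poly_(i < (size p).+1) (p`_i.-1 / i%:R)).
apply/polyP => i; rewrite coef_deriv coef_poly ltnS.
case: ltnP => [_|hi]; last by rewrite mul0rn nth_default.
by rewrite /= -[LHS]mulr_natr mulfVK// pnatr_eq0.
Qed.

Lemma Rintegral_poly (R : realType) (F : {poly R}) (a b : R) : a < b ->
  \int[@lebesgue_measure R]_(x in `[a, b]) (F^`()).[x] = F.[b] - F.[a].
Proof.
move=> ab; rewrite /Rintegral (@continuous_FTC2 _ _ (horner F))//.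
- by apply: continuous_subspaceT; exact: continuous_horner.
- split.
  + by move=> x _; exact: derivable_horner.
  + by apply: cvg_at_right_filter; exact: continuous_horner.
  + by apply: cvg_at_left_filter; exact: continuous_horner.
- by move=> x _; rewrite -derivE.
Qed.

(** Transport of exactness from [-1, 1] to [a, a + h]: with s the affine map between
    the intervals and F an antiderivative of p, (2 / h) F(s) is an antiderivative of
    p(s), so both integrals are differences of the same values of F. *)
Lemma quad_itv (R : realType) (N : nat) (r : quad_rule R N) (d : nat) :
  quad_exact r d -> forall (p : {poly R}) (a h : R), 0 < h -> (size p <= d.+1)%N ->
  \int[@lebesgue_measure R]_(x in `[a, a + h]) p.[x] =
  h * \sum_(q < N) weight r q * p.[a + h * ((1 + node r q) / 2)].
Proof.
move=> hr p a h h0 hp; have [F Fp] := poly_antiderivative p.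
pose s : {poly R} := (a + h / 2)%:P + (h / 2) *: 'X.
have sE t : s.[t] = a + h * ((1 + t) / 2) by rewrite hornerD hornerZ hornerC hornerX; field.
have hs : s^`() = (h / 2)%:P.
  by rewrite derivD derivC derivZ derivX add0r alg_polyC.
have := hr (p \Po s).
have szs : (size s <= 2)%N.
  rewrite (leq_trans (size_polyD _ _))// geq_max size_polyC (leq_trans (size_scale_leq _ _)) ?size_polyX// andbT.
  by case: (_ != 0).
have -> : (size (p \Po s) <= d.+1)%N.
  have [->|p0] := eqVneq p 0; first by rewrite comp_poly0 size_poly0.
  rewrite (leq_trans (size_comp_poly_leq _ _))// ltnS.
  rewrite -[leqRHS]muln1 leq_mul//; last by case: (size s) szs => //= -[|[]].
  by move: hp; case: (size p).
move=> /(_ isT); under eq_bigr do rewrite horner_comp sE.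
move=> ->.
pose H : {poly R} := (2 / h) *: (F \Po s).
have HE : H^`() = p \Po s.
  rewrite derivZ deriv_comp Fp hs [_ * _%:P]mulrC mul_polyC scalerA.
  by rewrite (_ : 2 / h * (h / 2) = 1) ?scale1r//; field; rewrite gt_eqF.
rewrite -HE Rintegral_poly; last by lra.
rewrite -Fp Rintegral_poly; last by lra.
rewrite /H !hornerZ !horner_comp !sE.
have -> : a + h * ((1 + 1) / 2) = a + h by field.
have -> : a + h * ((1 + - 1) / 2) = a by field.
by field; rewrite gt_eqF.
Qed.

(** If F is an antiderivative of p, so is F(-X), and the two give opposite values of
    the integral. *)
Lemma Rintegral_odd_poly (R : realType) (p : {poly R}) : p \Po (- 'X) = - p ->
  \int[@lebesgue_measure R]_(x in `[(-1 : R), 1]) p.[x] = 0.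
Proof.
move=> hp; have [F Fp] := poly_antiderivative p.
have GE : (F \Po (- 'X))^`() = p.
  by rewrite deriv_comp Fp hp derivN derivX mulrN1 opprK.
have I1 := @Rintegral_poly R F (-1) 1 ltac:(lra).
have := @Rintegral_poly R (F \Po (- 'X)) (-1) 1 ltac:(lra).
rewrite GE; rewrite Fp in I1; rewrite !horner_comp !hornerE opprK.
by rewrite I1; lra.
Qed.

Lemma quad_weights_sum1 (R : realType) (N : nat) (r : quad_rule R N) (d : nat) :
  quad_exact r d -> \sum_(q < N) weight r q = 1.
Proof.
move=> /(_ 1); rewrite size_poly1 => /(_ isT).
under eq_bigr do rewrite hornerC mulr1.
move=> ->; have -> : (1 : {poly R}) = deriv 'X by rewrite derivX.
by rewrite Rintegral_poly ?hornerX; lra.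
Qed.

(** The test polynomial sees the node q only, so by exactness its integral is a positive
    multiple of the weight. *)
Lemma quad_weight_ge0 (R : realType) (N : nat) (r : quad_rule R N) (d : nat)
    (p : {poly R}) (q : 'I_N) :
  quad_exact r d -> (size p <= d.+1)%N ->
  (forall x, -1 <= x <= 1 -> 0 <= p.[x]) ->
  (forall k, k != q -> p.[node r k] = 0) -> 0 < p.[node r q] ->
  0 <= weight r q.
Proof.
move=> hr /hr + p0 pk pq; rewrite (bigD1 q)//= big1 ?addr0; last first.
  by move=> k kq; rewrite pk ?mulr0.
by move=> wE; rewrite -(pmulr_lge0 _ pq) wE divr_ge0// Rintegral_ge0.
Qed.

Definition nodal (R : realType) (N : nat) (r : quad_rule R N) (A : {set 'I_N}) :
  {poly R} := \prod_(k in A) ('X - (node r k)%:P).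

Lemma size_nodal (R : realType) (N : nat) (r : quad_rule R N) (A : {set 'I_N}) :
  size (nodal r A) = #|A|.+1.
Proof. by rewrite /nodal -big_enum size_prod_XsubC -cardE. Qed.

Lemma nodal_eq0 (R : realType) (N : nat) (r : quad_rule R N) (A : {set 'I_N}) x :
  ((nodal r A).[x] == 0) = [exists k in A, x == node r k].
Proof.
rewrite /nodal horner_prod; apply/prodf_eq0/existsP.
  by move=> [k kA]; rewrite !hornerE subr_eq0 => xk; exists k; rewrite kA.
by move=> [k /andP[kA xk]]; exists k => //; rewrite !hornerE subr_eq0.
Qed.

(** The square of the nodal polynomial of the other nodes has degree 2Q - 2, one less
    than the degree of exactness. *)
Lemma gauss_weight_ge0 (R : realType) (Q : nat) (g : quad_rule R Q) (q : 'I_Q) :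
  is_gauss g -> 0 <= weight g q.
Proof.
move=> [Q0 inj _ hg]; pose P := nodal g [set~ q].
apply: (quad_weight_ge0 (p := P * P) hg).
- rewrite (leq_trans (size_polyMleq _ _))// size_nodal cardsC1 card_ord prednK//; lia.
- by move=> x _; rewrite hornerM -expr2 sqr_ge0.
- move=> k kq; apply/eqP; rewrite hornerM mulf_eq0 orbb nodal_eq0.
  by apply/existsP; exists k; rewrite !inE kq eqxx.
- rewrite hornerM -expr2 exprn_even_gt0//= nodal_eq0.
  apply/existsP => -[k]; rewrite !inE => /andP[kq /eqP/inj kE].
  by rewrite kE eqxx in kq.
Qed.

(** Let P be the nodal polynomial of the inner nodes.  X P(X) P(-X) is odd, so its
    integral vanishes; its degree 2N + 1 is the degree of exactness; and it vanishes at
    the inner nodes.  What is left of the quadrature sum is the difference of the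
    endpoint weights times P(1) P(-1). *)
Lemma gauss_lobatto_symm (R : realType) (N : nat) (r : quad_rule R N.+2) :
  is_gauss_lobatto r -> weight r ord_max = weight r ord0.
Proof.
move=> [inj rb r0 r1 hr].
pose A : {set 'I_N.+2} := ~: [set ord0; ord_max].
have om : (ord_max : 'I_N.+2) != ord0 by [].
have cA : #|A| = N.
  by rewrite cardsCs finset.setCK cards2 card_ord eq_sym om subn2.
pose P := nodal r A; pose P' := P \Po (- 'X).
have P0 (k : 'I_N.+2) : k \notin A -> P.[node r k] != 0.
  move=> kA; rewrite nodal_eq0; apply/existsP => -[l /andP[lA /eqP/inj kl]].
  by rewrite kl lA in kA.
have P1 : P.[1] != 0 by rewrite -r1 P0// !inE eqxx orbT.
have PN1 : P.[-1] != 0 by rewrite -r0 P0// !inE eqxx.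
have szP' : (size P' <= N.+1)%N.
  by rewrite (leq_trans (size_comp_poly_leq _ _))// size_polyN size_polyX size_nodal cA muln1.
have sz : (size ('X * (P * P'))%R <= (2 * N.+2 - 3).+1)%N.
  have := size_polyMleq P P'; have := size_polyMleq ('X : {poly R}) (P * P').
  rewrite size_polyX size_nodal cA.
  move: szP'; move: (size P') (size (P * P')) (size ('X * (P * P'))) => a b c; lia.
have := hr _ sz; rewrite Rintegral_odd_poly; last first.
  by rewrite !comp_polyM comp_polyX /P' -comp_polyA linearN /= comp_polyX opprK comp_polyXr mulNr [_ * P]mulrC.
rewrite mul0r (bigD1 ord0)// (bigD1 ord_max)//= big1 ?addr0; last first.
  move=> k /andP[k0 km]; apply/eqP; rewrite !hornerM.
  have -> : P.[node r k] = 0.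
    by apply/eqP; rewrite nodal_eq0; apply/existsP; exists k; rewrite !inE (negPf k0) (negPf km) eqxx.
  by rewrite !(mul0r, mulr0).
rewrite r0 r1 !hornerM !horner_comp !hornerN !hornerX opprK => h.
have : (weight r ord_max - weight r ord0) * (P.[1] * P.[-1]) = 0 by rewrite -h; ring.
by move/eqP; rewrite mulf_eq0 mulf_eq0 (negPf P1) (negPf PN1) !orbF subr_eq0 => /eqP.
Qed.

(** The factor 1 - X^2 removes both endpoints and is nonnegative on the interval; with
    the square of the nodal polynomial of the other inner nodes the degree is 2N. *)
Lemma gauss_lobatto_inner_weight_ge0 (R : realType) (N : nat) (r : quad_rule R N.+2)
    (b : 'I_N.+2) :
  is_gauss_lobatto r -> b != ord0 -> b != ord_max -> 0 <= weight r b.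
Proof.
move=> [inj rb r0 r1 hr] b0 b1.
pose A : {set 'I_N.+2} := ~: [set b; ord0; ord_max].
have om : (ord_max : 'I_N.+2) != ord0 by [].
have cA : (#|A| + 3 = N.+2)%N.
  by rewrite -[RHS](card_ord N.+2) -(cardsC [set b; ord0; ord_max]) -/A addnC -finset.setUA cardsU1 cards2 !inE negb_or b0 b1 eq_sym om.
pose P := nodal r A; pose S : {poly R} := ('X + 1) * (1 - 'X).
have SE x : S.[x] = (x + 1) * (1 - x) by rewrite !hornerE.
have sS : (size S <= 3)%N.
  have -> : S = 1 - 'X ^+ 2 by rewrite /S; ring.
  rewrite (leq_trans (size_polyD _ _))// geq_max size_poly1 size_polyN size_polyXn//.
apply: (quad_weight_ge0 (p := S * (P * P)) hr).
- have := size_polyMleq P P; have := size_polyMleq S (P * P).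
  rewrite size_nodal; move: (size (P * P)) (size (S * (P * P))) sS => x y; move: (size S) => z; lia.
- move=> x /andP[x1 x2]; rewrite hornerM SE; apply: mulr_ge0; first by apply: mulr_ge0; lra.
  by rewrite hornerM -expr2 sqr_ge0.
- move=> k kb; apply/eqP; rewrite hornerM SE [(P * P).[_]]hornerM !mulf_eq0 nodal_eq0.
  have [->|k0] := eqVneq k ord0; first by rewrite r0 addNr eqxx.
  have [->|k1] := eqVneq k ord_max; first by rewrite r1 subrr eqxx orbT.
  suff -> : [exists l in A, node r k == node r l] by rewrite !orbT.
  by apply/existsP; exists k; rewrite !inE (negPf kb) (negPf k0) (negPf k1) eqxx.
- have Sb : 0 < S.[node r b].
    have := rb b; rewrite SE => /andP[h1 h2].
    have : node r b != -1 by rewrite -r0 (inj_eq inj).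
    have : node r b != 1 by rewrite -r1 (inj_eq inj).
    move=> n1 n2; rewrite mulr_gt0//; last by rewrite subr_gt0 lt_neqAle n1.
    by rewrite -ltrBlDr sub0r lt_neqAle eq_sym n2.
  rewrite hornerM mulr_gt0// hornerM -expr2 exprn_even_gt0//= nodal_eq0.
  apply/existsP => -[k]; rewrite !inE => /andP[kq /eqP/inj kE].
  by rewrite kE eqxx in kq.
Qed.

(** * Cell averages of bivariate polynomials *)
Lemma size_horner_degree_le (R : realType) (K : nat) (p : {poly {poly R}}) (x : R) :
  degree_le K p -> (size p.[x%:P] <= K.+1)%N.
Proof.
move=> hp; apply/leq_sizeP => j Kj; rewrite horner_coef coef_sum big1// => i _.
rewrite -polyC_exp coefMC; have [->|/hp] := eqVneq p`_i`_j 0; first by rewrite mul0r.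
by move: Kj; lia.
Qed.

Lemma degree_le_swapXY (R : realType) (K : nat) (p : {poly {poly R}}) :
  degree_le K p -> degree_le K (swapXY p).
Proof. by move=> hp a b; rewrite coef_swapXY addnC; exact: hp. Qed.

Lemma integrable_poly (R : realType) (p : {poly R}) (a b : R) :
  (@lebesgue_measure R).-integrable `[a, b] (EFin \o horner p).
Proof.
apply: continuous_compact_integrable; first exact: segment_compact.
by apply: continuous_subspaceT; exact: continuous_horner.
Qed.

Lemma integral_polyE (R : realType) (p : {poly R}) (a b : R) :
  (\int[@lebesgue_measure R]_(x in `[a, b]) (p.[x])%:E)%E =
  (\int[@lebesgue_measure R]_(x in `[a, b]) p.[x])%:E.
Proof.
rewrite /Rintegral fineK//.
apply: integrable_fin_num; [exact: measurable_itv|exact: integrable_poly].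
Qed.

(** Expanding in powers of the first variable gives both measurability and a bound on
    the rectangle from bounds on one-variable polynomials. *)
Lemma integrable_poly2 (R : realType) (p : {poly {poly R}}) (a b c d : R) :
  (@lebesgue_measure R \x @lebesgue_measure R)%E.-integrable
    (`[a, b] `*` `[c, d]) (fun z => (p.[z.1, z.2])%:E).
Proof.
have fE (z : R * R) : p.[z.1, z.2] = \sum_(i < size p) (p`_i).[z.2] * z.1 ^+ i.
  rewrite (horner_coef p) horner_sum; apply: eq_bigr => i _.
  by rewrite hornerM -polyC_exp hornerC.
apply: measurable_bounded_integrable.
- by apply: measurableX; exact: measurable_itv.
- rewrite [ltLHS]product_measure1E//; do 2 ?exact: measurable_itv.
  have lm x y : (@lebesgue_measure R `[x, y] < +oo)%E.
    by rewrite lebesgue_measure_itv/=; case: ifP => // _; rewrite -EFinB ltry.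
  apply: lte_mul_pinfty => //; last exact: lm.
  by rewrite ge0_fin_numE//; exact: lm.
- apply: measurable_funTS; rewrite (funext fE).
  apply: measurable_sum => i; apply: measurable_realfun.measurable_funM.
    by apply: measurableT_comp => //; exact: measurable_poly.
  exact: measurable_realfun.measurable_funX.
- have ub i : exists M : R, forall y, c <= y <= d -> `|(p`_i).[y]| <= M.
    by have [M ?] := poly_itv_bound p`_i c d; exists M.
  have [M hM] := choice ub.
  pose e := Num.max `|a| `|b|.
  exists (\sum_(i < size p) `|M i| * e ^+ i); split; first exact: num_real.
  move=> x hx [x1 x2] [/= h1 h2]; have := fE (x1, x2) => /= ->; rewrite (le_trans _ (ltW hx))//.
  rewrite (le_trans (ler_norm_sum _ _ _))// ler_sum// => i _.
  rewrite normrM ler_pM//.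
    by rewrite (le_trans (hM i _ _))// ler_norm.
  rewrite normrX lerXn2r ?nnegrE ?normr_ge0//; first by rewrite /e le_max normr_ge0.
  move: h1; rewrite /= in_itv/= /e => /andP[ax xb].
  rewrite le_max; have [x0|x0] := lerP 0 x1.
    by rewrite (ger0_norm x0) (le_trans xb (ler_norm b)) orbT.
  by rewrite (ltr0_norm x0) -(normrN a) (le_trans _ (ler_norm (- a))) ?lerN2.
Qed.

(** After Fubini, exactness of s turns the inner integral into a polynomial P in the outer
    variable.  As the bound on the degree of p is on the total degree, P has degree at
    most K, and r is exact on it. *)
Lemma quad_itv2 (R : realType) (K N N' : nat) (r : quad_rule R N) (s : quad_rule R N')
    (p : {poly {poly R}}) (a b h k : R) :
  quad_exact r K -> quad_exact s K -> degree_le K p -> 0 < h -> 0 < k ->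
  \int[(@lebesgue_measure R \x @lebesgue_measure R)%E]_(z in `[a, a + h] `*` `[b, b + k])
     p.[z.1, z.2] =
  h * k * \sum_(q < N') weight s q * \sum_(c < N) weight r c *
     p.[a + h * ((1 + node r c) / 2), b + k * ((1 + node s q) / 2)].
Proof.
move=> hr hs hp h0 k0.
have mX : measurable `[a, a + h] by exact: measurable_itv.
have mY : measurable `[b, b + k] by exact: measurable_itv.
pose y q := b + k * ((1 + node s q) / 2).
pose P : {poly R} := \sum_(q < N') (k * weight s q) *: (swapXY p).[(y q)%:P].
have PE x : P.[x] = k * \sum_(q < N') weight s q * p.[x, y q].
  rewrite /P horner_sum mulr_sumr; apply: eq_bigr => q _.
  by rewrite hornerZ horner2_swapXY mulrA.
have szP : (size P <= K.+1)%N.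
  rewrite (leq_trans (size_sum _ _ _))//; apply/bigmax_leqP => q _.
  by rewrite (leq_trans (size_scale_leq _ _))// size_horner_degree_le//; exact: degree_le_swapXY.
have -> : \int[(@lebesgue_measure R \x @lebesgue_measure R)%E]_(z in `[a, a + h] `*` `[b, b + k])
     p.[z.1, z.2] = \int[@lebesgue_measure R]_(x in `[a, a + h]) P.[x].
  rewrite /Rintegral; congr fine.
  rewrite integral_mkcond -integral12_prod_meas1; last first.
    refine (iffLR (integrable_mkcond _ _) (integrable_poly2 p _ _ _ _)).
    by apply: measurableX; exact: measurable_itv.
  rewrite [RHS]integral_mkcond; apply: eq_integral => x _.
  rewrite /fubini_F/= [RHS]patchE; case: ifPn => [xX|xX]; last first.
    rewrite integral0_eq// => t _; rewrite patchE ifN// in_setX negb_and xX//.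
  transitivity (\int[@lebesgue_measure R]_(t in `[b, (b + k)%R]) ((p.[x%:P]).[t])%:E)%E.
    rewrite [RHS]integral_mkcond; apply: eq_integral => t _.
    by rewrite !patchE in_setX xX.
  by rewrite integral_polyE (quad_itv hs)//; [rewrite PE | exact: size_horner_degree_le].
rewrite (quad_itv hr)// -mulrA; congr (h * _).
under eq_bigr do rewrite PE mulrCA mulr_sumr.
rewrite -mulr_sumr exchange_big; congr (k * _); apply: eq_bigr => q _.
by rewrite mulr_sumr; apply: eq_bigr => c _; rewrite mulrCA.
Qed.

(** * States and linear functionals *)
Lemma dotvDl (R : realType) d (u u' w : 'rV[R]_d) : dotv (u + u') w = dotv u w + dotv u' w.
Proof. by rewrite -big_split; apply: eq_bigr => i _; rewrite mxE mulrDl. Qed.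

Lemma dotvZl (R : realType) d (a : R) (u w : 'rV[R]_d) : dotv (a *: u) w = a * dotv u w.
Proof. by rewrite mulr_sumr; apply: eq_bigr => i _; rewrite mxE mulrA. Qed.

Lemma dotvNl (R : realType) d (u w : 'rV[R]_d) : dotv (- u) w = - dotv u w.
Proof. by rewrite -scaleN1r dotvZl mulN1r. Qed.

Lemma dotvBl (R : realType) d (u u' w : 'rV[R]_d) : dotv (u - u') w = dotv u w - dotv u' w.
Proof. by rewrite dotvDl dotvNl. Qed.

Lemma dotv_suml (R : realType) d (I : Type) (s : seq I) (P : pred I) (F : I -> 'rV[R]_d) w :
  dotv (\sum_(i <- s | P i) F i) w = \sum_(i <- s | P i) dotv (F i) w.
Proof.
apply: (big_morph (fun u => dotv u w)) => [u u'|]; first exact: dotvDl.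
by rewrite /dotv big1// => i _; rewrite mxE mul0r.
Qed.

Lemma dotv0r (R : realType) d (u : 'rV[R]_d) : dotv u 0 = 0.
Proof. by rewrite /dotv big1// => i _; rewrite mxE mulr0. Qed.

Lemma dotvC (R : realType) d (u w : 'rV[R]_d) : dotv u w = dotv w u.
Proof. by apply: eq_bigr => i _; rewrite mulrC. Qed.

Lemma dotv_delta (R : realType) d (u : 'rV[R]_d) k : dotv u (delta_mx ord0 k) = u ord0 k.
Proof.
rewrite /dotv (bigD1 k)//= mxE !eqxx mulr1 big1 ?addr0// => i ik.
by rewrite mxE (negPf ik) andbF mulr0.
Qed.

Lemma dotv_row_mx (R : realType) d d' (u : 'rV[R]_(d + d')) (a : 'rV[R]_d) (b : 'rV[R]_d') :
  dotv u (row_mx a b) = dotv (lsubmx u) a + dotv (rsubmx u) b.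
Proof.
rewrite /dotv big_split_ord; congr (_ + _); apply: eq_bigr => i _.
  by rewrite row_mxEl mxE.
by rewrite row_mxEr mxE.
Qed.

Lemma dotv_scalar_mx (R : realType) (u : 'rV[R]_1) (c : R) : dotv u c%:M = u ord0 ord0 * c.
Proof. by rewrite /dotv big_ord1 mxE eqxx mulr1n. Qed.

Lemma dotv_mk_state (R : realType) (n : nat) (u : state R n) rY r m B E :
  dotv u (mk_state rY r m B E) =
  dotv (mass_frac_part u) rY + rho u * r + dotv (mom u) m + dotv (mag u) B + energy u * E.
Proof.
rewrite /mk_state !dotv_row_mx !dotv_scalar_mx !addrA.
by [].
Qed.

Section mk_state_proj.
Variables (R : realType) (n : nat) (rY : 'rV[R]_n) (r : R) (m B : 'rV[R]_3) (E : R).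
Let u := mk_state rY r m B E.

Lemma mass_frac_mk_state : mass_frac_part u = rY.
Proof. exact: row_mxKl. Qed.
Lemma rho_mk_state : rho u = r.
Proof. by rewrite /rho /u /mk_state row_mxKr row_mxKl mxE eqxx. Qed.
Lemma mom_mk_state : mom u = m.
Proof. by rewrite /mom /u /mk_state !row_mxKr row_mxKl. Qed.
Lemma mag_mk_state : mag u = B.
Proof. by rewrite /mag /u /mk_state !row_mxKr row_mxKl. Qed.
Lemma energy_mk_state : energy u = E.
Proof. by rewrite /energy /u /mk_state !row_mxKr mxE eqxx. Qed.
End mk_state_proj.

Definition mk_stateE := (mass_frac_mk_state, rho_mk_state, mom_mk_state, mag_mk_state,
  energy_mk_state).

Definition dir3 : 'I_3 := @Ordinal 3 2 isT.

Lemma dotv3 (R : realType) (u w : 'rV[R]_3) : dotv u w =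
  u ord0 dir1 * w ord0 dir1 + u ord0 dir2 * w ord0 dir2 + u ord0 dir3 * w ord0 dir3.
Proof.
rewrite /dotv !big_ord_recl big_ord0 addr0 addrA.
by congr (_ * _ + _ * _ + _ * _); congr (_ _ _); apply/val_inj.
Qed.

Lemma dir_cases (l : 'I_3) : [\/ l = dir1, l = dir2 | l = dir3].
Proof.
case: l => -[|[|[|//]]] h.
- by constructor 1; apply/val_inj.
- by constructor 2; apply/val_inj.
- by constructor 3; apply/val_inj.
Qed.

(** The internal energy per unit volume rho e: the pressure is (Gamma - 1) eint. *)
Definition eint (R : realType) (n : nat) (u : state R n) : R :=
  energy u - sqnorm (mom u) / (2 * rho u) - sqnorm (mag u) / 2.

Lemma mom_vel (R : realType) (n : nat) (u : state R n) : rho u != 0 -> mom u = rho u *: vel u.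
Proof. by move=> r0; rewrite /vel scalerA mulfV// scale1r. Qed.

Lemma energy_eint (R : realType) (n : nat) (u : state R n) : rho u != 0 ->
  energy u = eint u + rho u * sqnorm (vel u) / 2 + sqnorm (mag u) / 2.
Proof.
move=> r0; rewrite /eint mom_vel// /sqnorm !dotv3 !mxE; field.
by rewrite r0.
Qed.

(** phi is the total energy of the deviations v - v_star and B - B_star; this is where its
    positivity and all later bounds come from. *)
Lemma phiE (R : realType) (n : nat) (u : state R n) vs Bs : rho u != 0 ->
  phi u vs Bs = rho u * sqnorm (vel u - vs) / 2 + eint u + sqnorm (mag u - Bs) / 2.
Proof.
move=> r0; rewrite /phi dotv_mk_state dotv0r energy_eint// mom_vel//.
by rewrite /sqnorm !dotv3 !mxE; field; rewrite r0.
Qed.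

(** With w = v - v_star and b = B - B_star, the part of (flux . n_star) that is not
    transported by the velocity: it couples w with the pressure and with b, and it is
    this form that the fast speed has to dominate. *)
Definition bilin (R : realType) (l : 'I_3) (p : R) (B w b : 'rV[R]_3) : R :=
  p * w ord0 l + w ord0 l * dotv B b - B ord0 l * dotv w b.

(** The flux in terms of the deviations.  The first line is harmless: between two states it
    cancels up to the difference of their normal magnetic components.  The term
    v_star_l |B - B_star|^2 / 2 is cubic in the deviations when v_star_l is eliminated,
    hence is not controlled by phi for one state alone. *)
Lemma flux_nstarE (R : realType) (n : nat) (mix : mixture R n) (l : 'I_3) (u : state R n)
    (vs Bs : 'rV[R]_3) : rho u != 0 ->
  dotv (flux mix l u) (nstar n vs Bs) =
  mag u ord0 l * dotv vs Bs - vs ord0 l * sqnorm Bs / 2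
  + vel u ord0 l * (rho u * sqnorm (vel u - vs) / 2 + eint u)
  + vs ord0 l * (sqnorm (mag u - Bs) / 2)
  + bilin l (pressure mix u) (mag u) (vel u - vs) (mag u - Bs).
Proof.
move=> r0; rewrite dotv_mk_state dotv0r /flux !mk_stateE /ptot /bilin energy_eint// mom_vel//.
move: (pressure mix u) (eint u) (rho u) (vel u) (mag u) => p e r v B.
by case: (dir_cases l) => ->; rewrite /sqnorm !dotv3 !mxE /=; field.
Qed.

(** In the regrouped fluxes a jump of the normal magnetic component is multiplied by
    v_star . B_star.  The source completes this factor to a product of deviations. *)
Lemma source_nstarE (R : realType) (n : nat) (u : state R n) (vs Bs : 'rV[R]_3) :
  dotv (source u) (nstar n vs Bs) + dotv vs Bs = dotv (vel u - vs) (mag u - Bs).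
Proof.
rewrite dotv_mk_state dotv0r /source !mk_stateE !dotv3 !mxE; ring.
Qed.

(** * The fast speed as the norm of a bilinear form *)

(** lam is the largest root of lam^2 - s lam + a2 b1^2 = 0, that is the square of the norm of
    the matrix of the form in [fast_speed_form].  Multiplied by lam - b1^2, the difference
    of the two sides is a sum of squares by this equation; if lam = b1^2, the
    equation forces b1 b2 = b1 b3 = 0. *)
Lemma fast_speed_norm (R : realType) (a2 b1 b2 b3 lam x1 x2 x3 : R) :
  0 <= a2 ->
  let s := a2 + (b1 ^+ 2 + b2 ^+ 2 + b3 ^+ 2) in
  lam = (s + Num.sqrt (s ^+ 2 - 4 * a2 * b1 ^+ 2)) / 2 ->
  a2 * x1 ^+ 2 + (b2 * x1 - b1 * x2) ^+ 2 + (b3 * x1 - b1 * x3) ^+ 2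
    <= lam * (x1 ^+ 2 + x2 ^+ 2 + x3 ^+ 2).
Proof.
move=> a0 s lamE.
set q := s ^+ 2 - 4 * a2 * b1 ^+ 2 in lamE.
have qE : q = (a2 + b2 ^+ 2 + b3 ^+ 2 - b1 ^+ 2) ^+ 2 + 4 * b1 ^+ 2 * (b2 ^+ 2 + b3 ^+ 2).
  by rewrite /q /s; ring.
have p0 : 0 <= 4 * b1 ^+ 2 * (b2 ^+ 2 + b3 ^+ 2).
  by apply: mulr_ge0; [apply: mulr_ge0|apply: addr_ge0]; rewrite ?sqr_ge0.
have q0 : 0 <= q by rewrite qE addr_ge0// sqr_ge0.
set t := Num.sqrt q in lamE.
have t2 : t ^+ 2 = q by rewrite sqr_sqrtr.
have tge : `|a2 + b2 ^+ 2 + b3 ^+ 2 - b1 ^+ 2| <= t.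
  by rewrite -sqrtr_sqr; apply: ler_wsqrtr; rewrite qE lerDl; exact: p0.
(* The characteristic equation, factored so that P0 and Q0 below are its factors. *)
have charE : (lam - a2 - b2 ^+ 2 - b3 ^+ 2) * (lam - b1 ^+ 2) = b1 ^+ 2 * (b2 ^+ 2 + b3 ^+ 2).
  have -> : (lam - a2 - b2 ^+ 2 - b3 ^+ 2) * (lam - b1 ^+ 2) =
     (t ^+ 2 - (a2 + b2 ^+ 2 + b3 ^+ 2 - b1 ^+ 2) ^+ 2) / 4 by rewrite lamE /s; field.
  by rewrite t2 qE; field.
have P0 : 0 <= lam - a2 - b2 ^+ 2 - b3 ^+ 2.
  by have := le_trans (ler_norm _) tge; rewrite lamE /s; lra.
have Q0 : 0 <= lam - b1 ^+ 2.
  by have := ler_norm (- (a2 + b2 ^+ 2 + b3 ^+ 2 - b1 ^+ 2)); rewrite normrN => /le_trans/(_ tge); rewrite lamE /s; lra.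
rewrite -subr_ge0.
have -> : lam * (x1 ^+ 2 + x2 ^+ 2 + x3 ^+ 2) -
    (a2 * x1 ^+ 2 + (b2 * x1 - b1 * x2) ^+ 2 + (b3 * x1 - b1 * x3) ^+ 2) =
  (lam - a2 - b2 ^+ 2 - b3 ^+ 2) * x1 ^+ 2 + 2 * b1 * x1 * (b2 * x2 + b3 * x3)
  + (lam - b1 ^+ 2) * (x2 ^+ 2 + x3 ^+ 2) by ring.
move: Q0; rewrite le_eqVlt => /predU1P[Q0|Q0].
  move: charE; rewrite -Q0 mulr0 => /esym/eqP.
  have -> : b1 ^+ 2 * (b2 ^+ 2 + b3 ^+ 2) = (b1 * b2) ^+ 2 + (b1 * b3) ^+ 2 by ring.
  rewrite paddr_eq0 ?sqr_ge0// !sqrf_eq0 => /andP[/eqP h2 /eqP h3].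
  have -> : 2 * b1 * x1 * (b2 * x2 + b3 * x3) = 2 * x1 * ((b1 * b2) * x2 + (b1 * b3) * x3) by ring.
  by rewrite h2 h3 !mul0r !(addr0, mulr0) mulr_ge0// sqr_ge0.
rewrite -(pmulr_rge0 _ Q0).
have -> : (lam - b1 ^+ 2) * ((lam - a2 - b2 ^+ 2 - b3 ^+ 2) * x1 ^+ 2 + 2 * b1 * x1 * (b2 * x2 + b3 * x3)
  + (lam - b1 ^+ 2) * (x2 ^+ 2 + x3 ^+ 2)) =
  ((lam - a2 - b2 ^+ 2 - b3 ^+ 2) * (lam - b1 ^+ 2)) * x1 ^+ 2 +
  (lam - b1 ^+ 2) * (2 * b1 * x1 * (b2 * x2 + b3 * x3) + (lam - b1 ^+ 2) * (x2 ^+ 2 + x3 ^+ 2)) by ring.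
rewrite charE.
have -> : b1 ^+ 2 * (b2 ^+ 2 + b3 ^+ 2) * x1 ^+ 2 +
  (lam - b1 ^+ 2) * (2 * b1 * x1 * (b2 * x2 + b3 * x3) + (lam - b1 ^+ 2) * (x2 ^+ 2 + x3 ^+ 2)) =
  ((lam - b1 ^+ 2) * x2 + b1 * b2 * x1) ^+ 2 + ((lam - b1 ^+ 2) * x3 + b1 * b3 * x1) ^+ 2 by ring.
by rewrite addr_ge0// sqr_ge0.
Qed.

(** The left side is g . y with y = (z, y2, y3) and g linear in x; [fast_speed_norm]
    says |g| <= C |x|.  The square |C y - g|^2 gives the bound. *)
Lemma fast_speed_form (R : realType) (a b1 b2 b3 C x1 x2 x3 z y2 y3 : R) :
  0 < C ->
  let s := a ^+ 2 + (b1 ^+ 2 + b2 ^+ 2 + b3 ^+ 2) in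
  C ^+ 2 = (s + Num.sqrt (s ^+ 2 - 4 * a ^+ 2 * b1 ^+ 2)) / 2 ->
  a * x1 * z + x1 * (b2 * y2 + b3 * y3) - b1 * (x2 * y2 + x3 * y3)
    <= C * (x1 ^+ 2 + x2 ^+ 2 + x3 ^+ 2 + z ^+ 2 + y2 ^+ 2 + y3 ^+ 2) / 2.
Proof.
move=> C0 s CE.
have := fast_speed_norm x1 x2 x3 (sqr_ge0 a) CE.
set g1 := a * x1; set g2 := b2 * x1 - b1 * x2; set g3 := b3 * x1 - b1 * x3.
have -> : a ^+ 2 * x1 ^+ 2 = g1 ^+ 2 by rewrite /g1; ring.
move=> hg; rewrite -subr_ge0 -(pmulr_rge0 _ C0).
have -> : C * (C * (x1 ^+ 2 + x2 ^+ 2 + x3 ^+ 2 + z ^+ 2 + y2 ^+ 2 + y3 ^+ 2) / 2 -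
   (g1 * z + x1 * (b2 * y2 + b3 * y3) - b1 * (x2 * y2 + x3 * y3))) =
  ((C * z - g1) ^+ 2 + (C * y2 - g2) ^+ 2 + (C * y3 - g3) ^+ 2
   + (C ^+ 2 * (x1 ^+ 2 + x2 ^+ 2 + x3 ^+ 2) - (g1 ^+ 2 + g2 ^+ 2 + g3 ^+ 2))) / 2.
  by rewrite /g2 /g3; field.
apply: divr_ge0 => //; apply: addr_ge0; last by rewrite subr_ge0.
by rewrite !addr_ge0// sqr_ge0.
Qed.

Lemma sqnorm_ge0 (R : realType) d (u : 'rV[R]_d) : 0 <= sqnorm u.
Proof. by apply: sumr_ge0 => i _; rewrite -expr2 sqr_ge0. Qed.

Lemma fast_speed_gt0 (R : realType) (n : nat) (mix : mixture R n) (l : 'I_3) (u : state R n) :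
  0 < rho u -> 0 < sound2 mix u -> 0 < fast_speed mix l u.
Proof.
move=> r0 a0; rewrite /fast_speed mulr_gt0 ?invr_gt0 ?sqrtr_gt0//.
rewrite ltr_wpDr ?sqrtr_ge0// ltr_wpDr// divr_ge0 ?sqnorm_ge0 ?ltW//.
Qed.

Lemma fast_speed_sqr (R : realType) (n : nat) (mix : mixture R n) (l : 'I_3) (u : state R n) :
  0 < rho u -> 0 < sound2 mix u ->
  let s := sound2 mix u + sqnorm (mag u) / rho u in
  fast_speed mix l u ^+ 2 =
    (s + Num.sqrt (s ^+ 2 - 4 * sound2 mix u * (mag u ord0 l) ^+ 2 / rho u)) / 2.
Proof.
move=> r0 a0 s; rewrite /fast_speed exprMn exprVn !sqr_sqrtr//; first by rewrite [LHS]mulrC.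
apply: addr_ge0; rewrite ?sqrtr_ge0//; apply: addr_ge0; first exact: ltW.
by rewrite divr_ge0 ?sqnorm_ge0 ?ltW.
Qed.

(** Coordinates with the direction l first, so that all directions are treated at once. *)
Lemma dotv_split (R : realType) (l : 'I_3) : exists j k : 'I_3, forall x y : 'rV[R]_3,
  dotv x y = x ord0 l * y ord0 l + x ord0 j * y ord0 j + x ord0 k * y ord0 k.
Proof.
case: (dir_cases l) => ->; [exists dir2, dir3|exists dir1, dir3|exists dir1, dir2];
  by move=> x y; rewrite dotv3; ring.
Qed.

(** [fast_speed_form] for x = sqrt rho w, with z such that a x_l z = p w_l.  Then
    z^2 = p / Gamma = ((Gamma - 1) / Gamma) rho e, whereas the form leaves room for 2 rho e:
    this margin makes the inequality strict. *)
Lemma bilin_le (R : realType) (n : nat) (mix : mixture R n) (l : 'I_3) (u : state R n)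
    (w b : 'rV[R]_3) :
  0 < rho u -> 0 < pressure mix u -> 1 < Gam mix u ->
  bilin l (pressure mix u) (mag u) w b <
  fast_speed mix l u * (rho u * sqnorm w / 2 + eint u + sqnorm b / 2).
Proof.
move=> r0 p0 g1.
have G0 : 0 < Gam mix u by apply: lt_trans g1.
have a20 : 0 < sound2 mix u by rewrite divr_gt0// mulr_gt0.
have C0 := fast_speed_gt0 l r0 a20.
have CE := fast_speed_sqr l r0 a20.
set C := fast_speed mix l u in C0 CE *.
set rr := Num.sqrt (rho u); have rr0 : 0 < rr by rewrite sqrtr_gt0.
have rr2 : rho u = rr ^+ 2 by rewrite sqr_sqrtr// ltW.
set a := Num.sqrt (sound2 mix u); have aa0 : 0 < a by rewrite sqrtr_gt0.
have a2E : sound2 mix u = a ^+ 2 by rewrite sqr_sqrtr// ltW.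
set p := pressure mix u in p0 *.
pose z := p / (a * rr).
have z2 : z ^+ 2 < 2 * eint u.
  have -> : z ^+ 2 = p / Gam mix u.
    have -> : z ^+ 2 = p ^+ 2 / (a ^+ 2 * rr ^+ 2) by rewrite /z; field; rewrite !gt_eqF.
    rewrite -a2E -rr2 /sound2 -/p; field.
    by rewrite !gt_eqF.
  have pE : p = (Gam mix u - 1) * eint u by [].
  rewrite ltr_pdivrMr// {1}pE.
  have e0 : 0 < eint u by move: p0; rewrite pE pmulr_rgt0// subr_gt0.
  by rewrite [ltRHS]mulrC mulrA ltr_pM2r//; lra.
suff : bilin l p (mag u) w b <= C * (rho u * sqnorm w + z ^+ 2 + sqnorm b) / 2.
  move=> /le_lt_trans; apply; rewrite -mulrA ltr_pM2l//; lra.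
have [j [k jk]] := dotv_split R l.
have CE' : C ^+ 2 = (a ^+ 2 + ((mag u ord0 l / rr) ^+ 2 + (mag u ord0 j / rr) ^+ 2
      + (mag u ord0 k / rr) ^+ 2) + Num.sqrt ((a ^+ 2 + ((mag u ord0 l / rr) ^+ 2
      + (mag u ord0 j / rr) ^+ 2 + (mag u ord0 k / rr) ^+ 2)) ^+ 2
      - 4 * a ^+ 2 * (mag u ord0 l / rr) ^+ 2)) / 2.
  rewrite CE a2E.
  have -> : sqnorm (mag u) / rho u = (mag u ord0 l / rr) ^+ 2 + (mag u ord0 j / rr) ^+ 2
      + (mag u ord0 k / rr) ^+ 2.
    by rewrite /sqnorm jk rr2; field; rewrite gt_eqF.
  have -> // : 4 * a ^+ 2 * mag u ord0 l ^+ 2 / rho u = 4 * a ^+ 2 * (mag u ord0 l / rr) ^+ 2.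
  by rewrite rr2; field; rewrite gt_eqF.
have := fast_speed_form (rr * w ord0 l) (rr * w ord0 j) (rr * w ord0 k) z
  (b ord0 j) (b ord0 k) C0 CE'.
have -> : a * (rr * w ord0 l) * z + rr * w ord0 l * (mag u ord0 j / rr * b ord0 j
    + mag u ord0 k / rr * b ord0 k) - mag u ord0 l / rr * (rr * w ord0 j * b ord0 j
    + rr * w ord0 k * b ord0 k) = bilin l p (mag u) w b.
  by rewrite /bilin /z !jk; field; rewrite !gt_eqF.
move=> /le_trans; apply; rewrite ler_pM2r// ler_pM2l// /sqnorm !jk rr2.
by have := sqr_ge0 (b ord0 l); lra.
Qed.

(** * Bounds on the invariant region *)
Lemma Y_ord_max (R : realType) (n : nat) (u : state R n) :
  Y u ord_max = 1 - \sum_(k < n) mass_frac_part u ord0 k / rho u.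
Proof. by rewrite /Y insubF//= ltnn. Qed.

Lemma Y_widen (R : realType) (n : nat) (u : state R n) (k : 'I_n) :
  Y u (widen_ord (leqnSn n) k) = mass_frac_part u ord0 k / rho u.
Proof.
rewrite /Y insubT/=; first exact: ltn_ord.
by move=> h; congr (mass_frac_part u ord0 _ / _); apply/val_inj.
Qed.

Lemma sum_Y (R : realType) (n : nat) (u : state R n) : \sum_k Y u k = 1.
Proof.
rewrite big_ord_recr/= Y_ord_max; under eq_bigr do rewrite Y_widen.
by rewrite addrC subrK.
Qed.

Lemma weighted_sum_gt0 (R : realType) (I : finType) (w F : I -> R) :
  (forall q, 0 <= w q) -> \sum_q w q = 1 -> (forall q, 0 < F q) -> 0 < \sum_q w q * F q.
Proof.
move=> w0 w1 F0; rewrite lt_neqAle sumr_ge0 ?andbT => [|q _]; last by rewrite mulr_ge0// ltW.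
apply/negP => /eqP/esym/eqP; rewrite psumr_eq0 => [|q _]; last by rewrite mulr_ge0// ltW.
move=> /allP h; have := w1; rewrite big1 => [/eqP|q _]; first by rewrite eq_sym oner_eq0.
by have := h q; rewrite mem_index_enum mulf_eq0 (gt_eqF (F0 q)) orbF => /(_ isT)/eqP.
Qed.

Lemma weighted_Y_gt0 (R : realType) (n : nat) (u : state R n) (c : 'I_n.+1 -> R) :
  (forall k, 0 < c k) -> (forall k, 0 <= Y u k) -> 0 < \sum_k c k * Y u k.
Proof.
move=> c0 Y0; under eq_bigr do rewrite mulrC.
by apply: weighted_sum_gt0 => //; exact: sum_Y.
Qed.

Section invariant_region.
Variables (R : realType) (n : nat) (mix : mixture R n).
Hypothesis hCv : forall k, 0 < heat_cap mix k.
Hypothesis hGam : forall k, 1 < adiab mix k.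

Lemma Gam_gt1 (u : state R n) : G mix u -> 1 < Gam mix u.
Proof.
move=> [hY _]; have Y0 k : 0 <= Y u k by have /andP[] := hY k.
rewrite /Gam ltr_pdivlMr ?mul1r ?weighted_Y_gt0// -subr_gt0 -sumrB.
under eq_bigr do rewrite -mulrBl -[X in _ * _ - X]mul1r -mulrBl.
by apply: weighted_Y_gt0 => // k; rewrite mulr_gt0// subr_gt0.
Qed.

Lemma G_rho_gt0 (u : state R n) : G mix u -> 0 < rho u. Proof. by move=> [_ []]. Qed.

Lemma G_pressure_gt0 (u : state R n) : G mix u -> 0 < pressure mix u.
Proof. by move=> [_ []]. Qed.

Lemma G_eint_gt0 (u : state R n) : G mix u -> 0 < eint u.
Proof.
move=> Gu; have := G_pressure_gt0 Gu.
by rewrite /pressure -/(eint u) pmulr_rgt0// subr_gt0 Gam_gt1.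
Qed.

Lemma G_fast_speed_gt0 (l : 'I_3) (u : state R n) : G mix u -> 0 < fast_speed mix l u.
Proof.
move=> Gu; apply: fast_speed_gt0; first exact: G_rho_gt0.
apply: divr_gt0; last exact: G_rho_gt0.
by apply: mulr_gt0; [exact: lt_trans (Gam_gt1 Gu)|exact: G_pressure_gt0].
Qed.

Lemma normr_bilin_lt (l : 'I_3) (u : state R n) (w b : 'rV[R]_3) : G mix u ->
  `|bilin l (pressure mix u) (mag u) w b| <
  fast_speed mix l u * (rho u * sqnorm w / 2 + eint u + sqnorm b / 2).
Proof.
move=> Gu; rewrite ltr_norml -ltrNl; apply/andP; split; last first.
  by apply: bilin_le; rewrite ?G_rho_gt0 ?G_pressure_gt0 ?Gam_gt1.
have -> : - bilin l (pressure mix u) (mag u) w b = bilin l (pressure mix u) (mag u) (- w) b.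
  by rewrite /bilin dotvNl [(- w) _ _]mxE; ring.
have -> : sqnorm w = sqnorm (- w) by rewrite /sqnorm !dotv3 !mxE; ring.
by apply: bilin_le; rewrite ?G_rho_gt0 ?G_pressure_gt0 ?Gam_gt1.
Qed.

Lemma phi_gt0 (u : state R n) vs Bs : G mix u -> 0 < phi u vs Bs.
Proof.
move=> Gu; have r0 := G_rho_gt0 Gu.
rewrite phiE ?gt_eqF// -addrA addrCA ltr_pwDl ?G_eint_gt0//.
by rewrite addr_ge0// divr_ge0// ?mulr_ge0 ?sqnorm_ge0// ltW.
Qed.

(** 2 sqrt rho |w . b| <= rho |w|^2 + |b|^2. *)
Lemma source_le (u : state R n) vs Bs : G mix u ->
  `|dotv (source u) (nstar n vs Bs) + dotv vs Bs| <= phi u vs Bs / Num.sqrt (rho u).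
Proof.
move=> Gu; have r0 := G_rho_gt0 Gu; have e0 := G_eint_gt0 Gu.
rewrite source_nstarE phiE ?gt_eqF//.
set rr := Num.sqrt (rho u); have rr0 : 0 < rr by rewrite sqrtr_gt0.
have rr2 : rho u = rr ^+ 2 by rewrite sqr_sqrtr// ltW.
move: (vel u - vs) (mag u - Bs) => w b.
rewrite ler_pdivlMr// -{1}(gtr0_norm rr0) -normrM rr2 ler_norml.
have pol : sqnorm (rr *: w + b) = rr ^+ 2 * sqnorm w + sqnorm b + 2 * (dotv w b * rr).
  by rewrite /sqnorm !dotv3 !mxE; ring.
have pol' : sqnorm (rr *: w - b) = rr ^+ 2 * sqnorm w + sqnorm b - 2 * (dotv w b * rr).
  by rewrite /sqnorm !dotv3 !mxE; ring.
move: (sqnorm_ge0 (rr *: w + b)) (sqnorm_ge0 (rr *: w - b)) e0; rewrite pol pol'.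
move: (rr ^+ 2 * sqnorm w) (sqnorm b) (dotv w b * rr) (eint u) => x y z e h1 h2 e0.
by apply/andP; split; lra.
Qed.

(** The arithmetic of [flux_pair_gt0].  A and b are the two parts of phi, transported by the
    velocity v of the state and by the common velocity vs respectively; T is the
    price of replacing vs, which is arbitrary, by the average vb. *)
Lemma pair_scalar (a M D A A' b b' v v' vb vs q q' C C' T : R) :
  0 <= A -> 0 <= A' -> 0 <= b -> 0 <= b' ->
  `|v| + C <= M -> `|v'| + C' <= M -> `|vb| + Num.max C C' <= M -> M + D <= a ->
  `|q| < C * (A + b) -> `|q'| < C' * (A' + b') ->
  `|T| <= D * (A + b + (A' + b')) -> vs * (b - b') = vb * (b - b') - T ->
  0 < a * (A + b + (A' + b')) - (v * A + vs * b + q) + (v' * A' + vs * b' + q').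
Proof.
move=> A0 A0' b0 b0' hv hv' hvb ha hq hq' hT eT.
have := ltr_normlW hq. rewrite ltr_norml in hq'; case/andP: hq' => hq' _ {}hq.
have {}hT := le_trans (ler_norm (- T)) (eq_ind_r (fun x => x <= _) hT (normrN T)).
have S0 : 0 <= A + b + (A' + b') by rewrite !addr_ge0.
have h1 := ler_wpM2r S0 ha.
have h2 : v * A + C * A <= M * A.
  by rewrite -mulrDl ler_wpM2r// (le_trans _ hv)// lerD2r ler_norm.
have h3 : - v' * A' + C' * A' <= M * A'.
  by rewrite -mulrDl ler_wpM2r// (le_trans _ hv')// lerD2r -normrN ler_norm.
have h4 : vb * b + C * b <= M * b.
  by rewrite -mulrDl ler_wpM2r// (le_trans _ hvb)// lerD ?ler_norm// le_max lexx.
have h5 : - vb * b' + C' * b' <= M * b'.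
  rewrite -mulrDl ler_wpM2r// (le_trans _ hvb)//; apply: lerD.
    by rewrite -normrN ler_norm.
  by rewrite le_max lexx orbT.
clear hv hv' hvb ha.
lra.
Qed.

(** Cauchy-Schwarz followed by 2 |X| |y| <= X^2 + |y|^2. *)
Lemma normrM_dotv_le (dB y : 'rV[R]_3) (X : R) :
  `|X * dotv dB y| <= enorm dB * (X ^+ 2 + sqnorm y) / 2.
Proof.
have N0 : 0 <= enorm dB by exact: sqrtr_ge0.
have N2 : enorm dB ^+ 2 = sqnorm dB by rewrite sqr_sqrtr// sqnorm_ge0.
have cs : dotv dB y ^+ 2 <= sqnorm dB * sqnorm y.
  rewrite -subr_ge0 /sqnorm !dotv3.
  rewrite [leRHS](_ : _ =
    (dB ord0 dir1 * y ord0 dir2 - dB ord0 dir2 * y ord0 dir1) ^+ 2 +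
    (dB ord0 dir1 * y ord0 dir3 - dB ord0 dir3 * y ord0 dir1) ^+ 2 +
    (dB ord0 dir2 * y ord0 dir3 - dB ord0 dir3 * y ord0 dir2) ^+ 2); last by ring.
  by rewrite !addr_ge0 ?sqr_ge0.
have y0 := sqnorm_ge0 y.
have r0 : 0 <= enorm dB * (X ^+ 2 + sqnorm y) / 2.
  by rewrite divr_ge0// mulr_ge0// addr_ge0// sqr_ge0.
rewrite -ler_sqr ?nnegrE// real_normK ?num_real// exprMn.
apply: le_trans (ler_wpM2l (sqr_ge0 X) cs) _.
rewrite -N2 -subr_ge0.
rewrite [leRHS](_ : _ = (enorm dB * (X ^+ 2 - sqnorm y)) ^+ 2 / 4); last by field.
by rewrite divr_ge0// sqr_ge0.
Qed.

(** For two states the terms v_star_l |b|^2 / 2 combine into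
    v_star_l (B - B') . (b + b') / 2.  Replace v_star_l by the average of v_l - w_l and
    v'_l - w'_l with weights proportional to sqrt rho and sqrt rho'.  The average of the
    velocities is the one in [alpha_hat]; the average of w and w', times
    (B - B') . (b + b') / 2, is now quadratic in the deviations, and with these weights it is at
    most |B - B'| / (sqrt rho + sqrt rho') times phi + phi', which is the last term of
    [alpha_hat]. *)
Lemma flux_pair_gt0 (l : 'I_3) (a : R) (u u' : state R n) (vs Bs : 'rV[R]_3) :
  G mix u -> G mix u' -> alpha_hat mix l u u' <= a ->
  0 < a * (phi u vs Bs + phi u' vs Bs)
      - dotv (flux mix l u) (nstar n vs Bs) + dotv (flux mix l u') (nstar n vs Bs)
      + (B_comp l u - B_comp l u') * dotv vs Bs.
Proof.
move=> Gu Gu'; have r0 := G_rho_gt0 Gu; have r0' := G_rho_gt0 Gu'.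
have e0 := G_eint_gt0 Gu; have e0' := G_eint_gt0 Gu'.
rewrite !phiE ?gt_eqF// !flux_nstarE ?gt_eqF// /alpha_hat /B_comp.
have hq := normr_bilin_lt l (vel u - vs) (mag u - Bs) Gu.
have hq' := normr_bilin_lt l (vel u' - vs) (mag u' - Bs) Gu'.
move: hq hq'.
set q := bilin _ _ _ _ _; set q' := bilin _ _ (mag u') _ _.
set C := fast_speed mix l u; set C' := fast_speed mix l u'.
set rr := Num.sqrt (rho u); set rr' := Num.sqrt (rho u').
have rr0 : 0 < rr by rewrite sqrtr_gt0.
have rr0' : 0 < rr' by rewrite sqrtr_gt0.
have rr2 : rho u = rr ^+ 2 by rewrite sqr_sqrtr// ltW.
have rr2' : rho u' = rr' ^+ 2 by rewrite sqr_sqrtr// ltW.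
have rrn : rr + rr' != 0 by rewrite gt_eqF// addr_gt0.
move=> hq hq'.
set M := Num.max _ _ => ha.
pose A := rho u * sqnorm (vel u - vs) / 2 + eint u.
pose A' := rho u' * sqnorm (vel u' - vs) / 2 + eint u'.
pose b := sqnorm (mag u - Bs) / 2; pose b' := sqnorm (mag u' - Bs) / 2.
pose X := rr * (vel u - vs) ord0 l + rr' * (vel u' - vs) ord0 l.
pose T := (rr + rr')^-1 * (X * dotv (mag u - mag u') (mag u - Bs + (mag u' - Bs))) / 2.
pose vb := (rr * vel u ord0 l + rr' * vel u' ord0 l) / (rr + rr').
pose D := enorm (mag u - mag u') / (rr + rr').
have w0 := sqnorm_ge0 (vel u - vs); have w0' := sqnorm_ge0 (vel u' - vs).
have XE : X = (rr + rr') * (vb - vs ord0 l).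
  by rewrite /X /vb ![(_ - vs) _ _]mxE ![(- vs) _ _]mxE; field.
have bE : b - b' = dotv (mag u - mag u') (mag u - Bs + (mag u' - Bs)) / 2.
  by rewrite /b /b'; move: (mag u) (mag u') => B B'; rewrite /sqnorm !dotv3 !mxE; field.
have eT : vs ord0 l * (b - b') = vb * (b - b') - T.
  by rewrite /T bE XE; field.
have hT : `|T| <= D * (A + b + (A' + b')).
  have hX : X ^+ 2 <= 2 * (rho u * sqnorm (vel u - vs) + rho u' * sqnorm (vel u' - vs)).
    rewrite /X rr2 rr2'; move: (vel u - vs) (vel u' - vs) => w w'.
    have [j [k jk]] := dotv_split R l; rewrite /sqnorm !jk -!expr2.
    rewrite -subr_ge0 [leRHS](_ : _ = (rr * w ord0 l - rr' * w' ord0 l) ^+ 2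
      + 2 * ((rr * w ord0 j) ^+ 2 + (rr * w ord0 k) ^+ 2 + ((rr' * w' ord0 j) ^+ 2
      + (rr' * w' ord0 k) ^+ 2))); last by ring.
    by rewrite addr_ge0 ?sqr_ge0// mulr_ge0// !addr_ge0 ?sqr_ge0.
  have hY : sqnorm (mag u - Bs + (mag u' - Bs)) <= 2 * (sqnorm (mag u - Bs) + sqnorm (mag u' - Bs)).
    move: (mag u - Bs) (mag u' - Bs) => y y'.
    rewrite -subr_ge0 [leRHS](_ : _ = sqnorm (y - y')) ?sqnorm_ge0//.
    by rewrite /sqnorm !dotv3 !mxE; ring.
  have N0 : 0 <= enorm (mag u - mag u') by exact: sqrtr_ge0.
  have iR0 : 0 < (rr + rr')^-1 by rewrite invr_gt0 addr_gt0.
  rewrite /T /D -mulrA normrM (gtr0_norm iR0) normrM [`|2^-1|]gtr0_norm ?invr_gt0//.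
  rewrite [enorm _ / _]mulrC -mulrA ler_pM2l// ler_pdivrMr//.
  apply: le_trans (normrM_dotv_le _ _ _) _.
  rewrite -!mulrA ler_wpM2l// ler_pdivrMr//.
  rewrite /A /A' /b /b'; lra.
have := @pair_scalar a M D A A' b b' (vel u ord0 l) (vel u' ord0 l) vb (vs ord0 l) q q' C C' T.
have -> : `|vb| = `|rr * vel u ord0 l + rr' * vel u' ord0 l| / (rr + rr').
  by rewrite /vb normrM normfV (gtr0_norm (addr_gt0 rr0 rr0')).
rewrite /M !le_max !lexx !orbT => h.
apply: lt_le_trans (h _ _ _ _ _ _ _ ha hq hq' hT eT) _ => //.
- by rewrite addr_ge0 ?(ltW e0)// divr_ge0// mulr_ge0// ltW.
- by rewrite addr_ge0 ?(ltW e0')// divr_ge0// mulr_ge0// ltW.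
- by rewrite divr_ge0// sqnorm_ge0.
- by rewrite divr_ge0// sqnorm_ge0.
by rewrite le_eqVlt; apply/orP; left; apply/eqP; rewrite /A /A' /b /b'; ring.
Qed.

Lemma normr_vel_lt_alpha (l : 'I_3) (a : R) (u u' : state R n) :
  G mix u -> G mix u' -> alpha_hat mix l u u' <= a ->
  `|vel u ord0 l| < a /\ `|vel u' ord0 l| < a.
Proof.
move=> Gu Gu'; rewrite /alpha_hat => ha.
have C0 := G_fast_speed_gt0 l Gu; have C0' := G_fast_speed_gt0 l Gu'.
have := le_trans _ ha => h.
have D0 : 0 <= enorm (mag u - mag u') / (Num.sqrt (rho u) + Num.sqrt (rho u')).
  by rewrite divr_ge0 ?addr_ge0 ?sqrtr_ge0.
split.
  apply: (lt_le_trans (y := `|vel u ord0 l| + fast_speed mix l u)); first by rewrite ltrDl.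
  by apply: h; rewrite -[leLHS]addr0 lerD// le_max lexx.
apply: (lt_le_trans (y := `|vel u' ord0 l| + fast_speed mix l u')); first by rewrite ltrDl.
by apply: h; rewrite -[leLHS]addr0 lerD// !le_max lexx orbT.
Qed.

End invariant_region.

(** * Regrouping the fluxes of two opposite faces *)

(** The scheme in one direction, for a functional psi of the states, the functionals f of the
    flux and s of the source, and the normal magnetic component b.  For
    phi( . ; v_star, B_star) the scalar k is v_star . B_star, and r is sqrt rho. *)
Section direction.
Variables (R : realType) (T : Type) (psi f s b r : T -> R) (a k : R).

Definition pair_term (u w : T) : R :=
  a * (psi u + psi w) - f u + f w + (b u - b w) * k.

Definition lf_flux (u w : T) : R := 2^-1 * (f u + f w - a * (psi w - psi u)).

(** um, up are the inner and outer traces on the right face, vp, vm those on the left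
    face.  The viscous terms of the two face fluxes are those of the pairs (up, vm) and
    (um, vp), less 2 a (psi um + psi vp).  The differences of b in these pairs add up to
    2 (b um - b vp), which goes to the discrete divergence, plus the two jumps, which
    combine with the source terms into jump (s + k). *)
Lemma direction_bound (Q : nat) (w : 'I_Q -> R) (um up vm vp : 'I_Q -> T) (sig eps : R) :
  0 <= sig -> (forall q, 0 <= w q) -> (forall u, 0 <= r u) ->
  (forall q, 0 <= psi (um q)) -> (forall q, 0 <= psi (vp q)) ->
  (forall q, `|s (um q) + k| <= psi (um q) / r (um q)) ->
  (forall q, `|s (vp q) + k| <= psi (vp q) / r (vp q)) ->
  (forall q, `|b (up q) - b (um q)| / r (um q) <= a * eps) ->
  (forall q, `|b (vp q) - b (vm q)| / r (vp q) <= a * eps) ->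
  sig / 2 * (\sum_q w q * (pair_term (up q) (vm q) + pair_term (um q) (vp q)))
  - sig * a * (1 + eps) * (\sum_q w q * (psi (um q) + psi (vp q)))
  - sig * k * (\sum_q w q * (b (um q) - b (vp q)))
  <= - (sig * ((\sum_q w q * lf_flux (um q) (up q)) - \sum_q w q * lf_flux (vm q) (vp q)))
     - sig / 2 * (\sum_q w q * ((b (up q) - b (um q)) * s (um q)
                              + (b (vp q) - b (vm q)) * s (vp q))).
Proof.
move=> sig0 w0 r0 um0 vp0 Sum Svp Jum Jvp.
rewrite mulrBr !mulr_sumr -!sumrB -!sumrN -!big_split/=.
apply: ler_sum => q _.
have term (u : T) J : 0 <= psi u -> `|s u + k| <= psi u / r u ->
    `|J| / r u <= a * eps -> J * (s u + k) <= a * eps * psi u.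
  move=> u0 Su Ju; apply: le_trans (ler_norm _) _; rewrite normrM.
  apply: (le_trans (ler_wpM2l (normr_ge0 J) Su)).
  by rewrite mulrCA mulrC ler_wpM2r.
have h1 := term _ _ (um0 q) (Sum q) (Jum q).
have h2 := term _ _ (vp0 q) (Svp q) (Jvp q).
rewrite -subr_ge0.
rewrite [leRHS](_ : _ = sig * w q / 2 * (
   (a * eps * psi (um q) - (b (up q) - b (um q)) * (s (um q) + k)) +
   (a * eps * psi (vp q) - (b (vp q) - b (vm q)) * (s (vp q) + k)) +
   (a * eps * psi (um q) + a * eps * psi (vp q)))); last first.
  by rewrite /pair_term /lf_flux; field.
apply: mulr_ge0; first by rewrite divr_ge0// mulr_ge0.
have ae0 : 0 <= a * eps by apply: le_trans (Jum q); rewrite divr_ge0.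
apply: addr_ge0; last by rewrite addr_ge0// mulr_ge0.
by apply: addr_ge0; rewrite subr_ge0.
Qed.
End direction.

Lemma quad_exact_le (R : realType) (N : nat) (r : quad_rule R N) (d d' : nat) :
  (d' <= d)%N -> quad_exact r d -> quad_exact r d'.
Proof. by move=> dd h p hp; apply: h; rewrite (leq_trans hp). Qed.

Lemma cell_average_quad (R : realType) (n K N N' : nat) (M : mesh R) (r : quad_rule R N)
    (s : quad_rule R N') (V : poly_state R n) (i j : int) :
  quad_exact r K -> quad_exact s K -> (forall k, degree_le K (V ord0 k)) ->
  0 < dx M -> 0 < dy M ->
  cell_average M i j V = \sum_(q < N') \sum_(b < N) (weight s q * weight r b) *:
    eval_state V (xpt M i (node r b)) (ypt M j (node s q)).
Proof.
move=> hr hs hV dx0 dy0; apply/rowP => k; rewrite mxE summxE /cell.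
have face x (o h : R) : o + (x + 1)%:~R * h = o + (x - 1 + 1)%:~R * h + h.
  by rewrite subrK intrD mulrDl mul1r addrA.
have -> : xface M i = xface M (i - 1) + dx M by rewrite /xface face.
have -> : yface M j = yface M (j - 1) + dy M by rewrite /yface face.
rewrite (quad_itv2 _ _ hr hs (hV k) dx0 dy0) [LHS]mulrC mulrA mulVf ?mul1r; last first.
  by rewrite mulf_neq0// gt_eqF.
apply: eq_bigr => q _; rewrite summxE mulr_sumr; apply: eq_bigr => b _.
by rewrite !mxE mulrA.
Qed.

Lemma xpt_N1 (R : realType) (M : mesh R) (i : int) : xpt M i (-1) = xface M (i - 1).
Proof. by rewrite /xpt subrr mul0r mulr0 addr0. Qed.

Lemma xpt_1 (R : realType) (M : mesh R) (i : int) : xpt M i 1 = xface M i.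
Proof. by rewrite /xpt /xface subrK intrD; field. Qed.

Lemma ypt_N1 (R : realType) (M : mesh R) (i : int) : ypt M i (-1) = yface M (i - 1).
Proof. by rewrite /ypt subrr mul0r mulr0 addr0. Qed.

Lemma ypt_1 (R : realType) (M : mesh R) (i : int) : ypt M i 1 = yface M i.
Proof. by rewrite /ypt /yface subrK intrD; field. Qed.

(** * Convexity of the average and the CFL condition *)
Lemma lobatto_convex_ge (R : realType) (N Q : nat) (gl : quad_rule R N.+2) (w : 'I_Q -> R)
    (F : 'I_Q -> 'I_N.+2 -> R) :
  is_gauss_lobatto gl -> (forall q, 0 <= w q) -> (forall q b, 0 <= F q b) ->
  weight gl ord0 * \sum_q w q * (F q ord_max + F q ord0) <=
  \sum_q \sum_b (w q * weight gl b) * F q b.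
Proof.
move=> hgl w0 F0; rewrite mulr_sumr; apply: ler_sum => q _.
rewrite (bigD1 ord0)// (bigD1 ord_max)//= (gauss_lobatto_symm hgl) addrA.
rewrite [leLHS](_ : _ = w q * weight gl ord0 * F q ord0 + w q * weight gl ord0 * F q ord_max);
  last by ring.
rewrite lerDl sumr_ge0// => b /andP[b0 b1].
by rewrite mulr_ge0// mulr_ge0// gauss_lobatto_inner_weight_ge0.
Qed.

(** As lam is positive, the CFL condition excludes an infinite epsilon, and a finite one
    bounds every jump. *)
Lemma epsilon_bound (R : realType) (n : nat) (M : mesh R) (Q : nat) (g : quad_rule R Q)
    (U : solution R n) (alpha1 alpha2 lam w : R) :
  (0 < Q)%N -> 0 < alpha1 -> 0 < alpha2 -> 0 < lam ->
  ((1 + epsilon M g U alpha1 alpha2) * lam%:E <= w%:E)%E ->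
  exists eps : R, [/\ (1 + eps) * lam <= w,
    forall i j q u, u = trace1m M g U i j q \/ u = trace1p M g U i j q ->
      `|jump1 M g U i j q| / Num.sqrt (rho u) <= alpha1 * eps &
    forall i j q u, u = trace2m M g U i j q \/ u = trace2p M g U i j q ->
      `|jump2 M g U i j q| / Num.sqrt (rho u) <= alpha2 * eps].
Proof.
move=> Q0 a1 a2 l0.
have h1 i j q u : u = trace1m M g U i j q \/ u = trace1p M g U i j q ->
    ((`|jump1 M g U i j q| / Num.sqrt (rho u) / alpha1)%:E <= epsilon M g U alpha1 alpha2)%E.
  move=> uE; have a1' : (0 <= (alpha1^-1)%:E)%E by rewrite lee_fin invr_ge0 ltW.
  rewrite /epsilon le_max EFinM lee_wpmul2r//.
  by apply: ereal_sup_ubound; exists i, j, q, u.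
have h2 i j q u : u = trace2m M g U i j q \/ u = trace2p M g U i j q ->
    ((`|jump2 M g U i j q| / Num.sqrt (rho u) / alpha2)%:E <= epsilon M g U alpha1 alpha2)%E.
  move=> uE; have a2' : (0 <= (alpha2^-1)%:E)%E by rewrite lee_fin invr_ge0 ltW.
  rewrite /epsilon le_max EFinM (lee_wpmul2r a2') ?orbT//.
  by apply: ereal_sup_ubound; exists i, j, q, u.
(* Any one of the bounds excludes the value -oo. *)
have := h1 0 0 (Ordinal Q0) _ (or_introl erefl).
case: epsilon h1 h2 => [e h1 h2 _|h1 h2 _|//].
  rewrite -EFinD -EFinM lee_fin => hw; exists e; split => // i j q u uE.
    by have := h1 i j q u uE; rewrite lee_fin ler_pdivrMr// [e * _]mulrC.
  by have := h2 i j q u uE; rewrite lee_fin ler_pdivrMr// [e * _]mulrC.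
by rewrite addey// mulyr gtr0_sg// mul1e leye_eq.
Qed.

(** * One step of the scheme *)
Lemma dotv_update (R : realType) d (A X X' Y Y' Z Z' e : 'rV[R]_d) (c s t h h' : R)
    (x x' y y' z z' : R) :
  dotv X e = x -> dotv X' e = x' -> dotv Y e = y -> dotv Y' e = y' ->
  dotv Z e = z -> dotv Z' e = z' ->
  dotv (A - s *: (X - X') - t *: (Y - Y') - (h *: Z + h' *: Z')) e + c =
  (dotv A e + c) + (- (s * (x - x')) - h * z) + (- (t * (y - y')) - h' * z').
Proof.
move=> <- <- <- <- <- <-.
by rewrite !(dotvBl, dotvDl, dotvNl, dotvZl); ring.
Qed.

Lemma dotv_flux_LF (R : realType) n (mix : mixture R n) l (a c : R) (e u v : state R n) :
  dotv (flux_LF mix l a u v) e =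
  lf_flux (fun u => dotv u e + c) (fun u => dotv (flux mix l u) e) a u v.
Proof.
rewrite /flux_LF /lf_flux dotvZl dotvBl dotvDl dotvZl dotvBl; congr (_ * (_ - _ * _)).
by rewrite opprD addrACA subrr addr0.
Qed.

Lemma dotv_wsum (R : realType) d (Q : nat) (w : 'I_Q -> R) (F : 'I_Q -> 'rV[R]_d) e :
  dotv (\sum_q w q *: F q) e = \sum_q w q * dotv (F q) e.
Proof. by rewrite dotv_suml; apply: eq_bigr => q _; rewrite dotvZl. Qed.

(** avg is the mean of itself with weights s1 a1 and s2 a2; bounding one copy in each direction
    makes the sum over traces appear with the weights it has in the scheme.  The B
    terms carry the same factor k and cancel as the discrete divergence vanishes. *)
Lemma cfl_absorb (R : realType) (avg P1 P2 S1 S2 B1 B2 s1 s2 a1 a2 eps k W : R) :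
  0 < s1 * a1 -> 0 < s2 * a2 -> 0 <= S1 -> 0 <= S2 -> W * S1 <= avg -> W * S2 <= avg ->
  (1 + eps) * (s1 * a1 + s2 * a2) <= W -> s1 * B1 + s2 * B2 = 0 ->
  s1 / 2 * P1 + s2 / 2 * P2 <=
  avg + (s1 / 2 * P1 - s1 * a1 * (1 + eps) * S1 - s1 * k * B1)
      + (s2 / 2 * P2 - s2 * a2 * (1 + eps) * S2 - s2 * k * B2).
Proof.
move=> l1 l2 S10 S20 A1 A2 CFL B0.
have L0 : 0 < s1 * a1 + s2 * a2 by rewrite addr_gt0.
suff h : (1 + eps) * (s1 * a1 * S1 + s2 * a2 * S2) <= avg.
  rewrite -subr_ge0 [leRHS](_ : _ = avg - (1 + eps) * (s1 * a1 * S1 + s2 * a2 * S2)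
    - k * (s1 * B1 + s2 * B2)); last by ring.
  by rewrite B0 mulr0 subr0 subr_ge0.
rewrite -(ler_pM2l L0) mulrA [_ * (1 + eps)]mulrC.
have T0 : 0 <= s1 * a1 * S1 + s2 * a2 * S2.
  by rewrite addr_ge0// mulr_ge0// ltW.
apply: le_trans (ler_wpM2r T0 CFL) _.
have h1 := ler_wpM2l (ltW l1) A1; have h2 := ler_wpM2l (ltW l2) A2.
rewrite [leRHS]mulrDl; apply: le_trans (lerD h1 h2).
by rewrite le_eqVlt; apply/orP; left; apply/eqP; ring.
Qed.

Section scheme.
Variables (R : realType) (n : nat) (mix : mixture R n).
Hypothesis hCv : forall k, 0 < heat_cap mix k.
Hypothesis hGam : forall k, 1 < adiab mix k.
Variables (M : mesh R) (dt : R) (K Q N : nat) (g : quad_rule R Q) (gl : quad_rule R N.+2).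
Hypotheses (hdx : 0 < dx M) (hdy : 0 < dy M) (hdt : 0 < dt).
Hypotheses (hg : is_gauss g) (hgK : quad_exact g K).
Hypotheses (hgl : is_gauss_lobatto gl) (hglK : quad_exact gl K).
Variables (U : solution R n) (alpha1 alpha2 : R).
Hypothesis hdeg : forall i j k, degree_le K (U i j ord0 k).
Hypothesis halpha1 : alpha1_ok mix M g U alpha1.
Hypothesis halpha2 : alpha2_ok mix M g U alpha2.
Hypothesis hnodes : forall i j (b : 'I_N.+2) (q : 'I_Q),
  G mix (eval_state (U i j) (xpt M i (node gl b)) (ypt M j (node g q))) /\
  G mix (eval_state (U i j) (xpt M i (node g q)) (ypt M j (node gl b))).
Hypothesis hdiv : forall i j, div_minus M g U i j = 0.
Hypothesis hCFL : ((1 + epsilon M g U alpha1 alpha2) *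
  (dt / dx M * alpha1 + dt / dy M * alpha2)%:E <= (weight gl ord0)%:E)%E.

Lemma G_trace1m i j q : G mix (trace1m M g U i j q).
Proof.
have [_ _ _ gl1 _] := hgl; have [+ _] := hnodes i j ord_max q.
by rewrite gl1 xpt_1.
Qed.

Lemma G_trace1p i j q : G mix (trace1p M g U i j q).
Proof.
have [_ _ gl0 _ _] := hgl; have [+ _] := hnodes (i + 1) j ord0 q.
by rewrite gl0 xpt_N1 addrK.
Qed.

Lemma G_trace2m i j q : G mix (trace2m M g U i j q).
Proof.
have [_ _ _ gl1 _] := hgl; have [_] := hnodes i j ord_max q.
by rewrite gl1 ypt_1.
Qed.

Lemma G_trace2p i j q : G mix (trace2p M g U i j q).
Proof.
have [_ _ gl0 _ _] := hgl; have [_] := hnodes i (j + 1) ord0 q.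
by rewrite gl0 ypt_N1 addrK.
Qed.

Let q0 : 'I_Q. Proof. by have [Q0 _ _ _] := hg; exact: Ordinal Q0. Defined.

Lemma alpha1_gt0 : 0 < alpha1.
Proof.
have [h _] := halpha1 0 0 q0.
have [+ _] := normr_vel_lt_alpha hCv hGam (G_trace1m 0 0 q0) (G_trace1p (0 - 1) 0 q0) h.
exact: le_lt_trans.
Qed.

Lemma alpha2_gt0 : 0 < alpha2.
Proof.
have [h _] := halpha2 0 0 q0.
have [+ _] := normr_vel_lt_alpha hCv hGam (G_trace2m 0 0 q0) (G_trace2p 0 (0 - 1) q0) h.
exact: le_lt_trans.
Qed.

Section functional.
Variables (e : state R n) (c k : R).
Let psi (u : state R n) : R := dotv u e + c.
Let pairs l a := pair_term psi (fun u => dotv (flux mix l u) e) (B_comp l) a k.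

(** What is left of the scheme once the inner traces have been absorbed by the average. *)
Definition face_pairs (i j : int) : R :=
  dt / dx M / 2 * (\sum_q weight g q *
    (pairs dir1 alpha1 (trace1p M g U i j q) (trace1m M g U (i - 1) j q) +
     pairs dir1 alpha1 (trace1m M g U i j q) (trace1p M g U (i - 1) j q))) +
  dt / dy M / 2 * (\sum_q weight g q *
    (pairs dir2 alpha2 (trace2p M g U i j q) (trace2m M g U i (j - 1) q) +
     pairs dir2 alpha2 (trace2m M g U i j q) (trace2p M g U i (j - 1) q))).

Hypothesis psi_ge0 : forall u, G mix u -> 0 <= psi u.
Hypothesis psi_source : forall u, G mix u ->
  `|dotv (source u) e + k| <= psi u / Num.sqrt (rho u).

Let w0 q : 0 <= weight g q. Proof. exact: gauss_weight_ge0. Qed.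
Let w1 : \sum_q weight g q = 1. Proof. exact: quad_weights_sum1 hgK. Qed.

Lemma average_ge1 i j :
  weight gl ord0 * (\sum_q weight g q *
     (psi (trace1m M g U i j q) + psi (trace1p M g U (i - 1) j q)))
  <= psi (cell_average M i j (U i j)).
Proof.
have [_ _ gl0 gl1 _] := hgl.
have -> : psi (cell_average M i j (U i j)) = \sum_q \sum_b (weight g q * weight gl b) *
    psi (eval_state (U i j) (xpt M i (node gl b)) (ypt M j (node g q))).
  rewrite (cell_average_quad i j hglK hgK (@hdeg i j))// /psi dotv_suml.
  under eq_bigr do rewrite dotv_suml.
  under [RHS]eq_bigr do (under eq_bigr do rewrite mulrDr; rewrite big_split/=).
  rewrite big_split/=; congr (_ + _).
    by apply: eq_bigr => q _; apply: eq_bigr => b _; rewrite dotvZl.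
  under eq_bigr do (rewrite -mulr_suml -mulr_sumr (quad_weights_sum1 hglK) mulr1).
  by rewrite -mulr_suml w1 mul1r.
apply: le_trans (lobatto_convex_ge hgl w0 _); last first.
  by move=> q b; apply: psi_ge0; have [] := hnodes i j b q.
by rewrite /trace1p subrK gl0 gl1 xpt_1 xpt_N1.
Qed.

Lemma average_ge2 i j :
  weight gl ord0 * (\sum_q weight g q *
     (psi (trace2m M g U i j q) + psi (trace2p M g U i (j - 1) q)))
  <= psi (cell_average M i j (U i j)).
Proof.
have [_ _ gl0 gl1 _] := hgl.
have -> : psi (cell_average M i j (U i j)) = \sum_q \sum_b (weight g q * weight gl b) *
    psi (eval_state (U i j) (xpt M i (node g q)) (ypt M j (node gl b))).
  rewrite (cell_average_quad i j hgK hglK (@hdeg i j))// exchange_big /psi dotv_suml.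
  under eq_bigr do rewrite dotv_suml.
  under [RHS]eq_bigr do (under eq_bigr do rewrite mulrDr; rewrite big_split/=).
  rewrite big_split/=; congr (_ + _).
    by apply: eq_bigr => q _; apply: eq_bigr => b _; rewrite dotvZl [weight gl b * _]mulrC.
  under eq_bigr do (rewrite -mulr_suml -mulr_sumr (quad_weights_sum1 hglK) mulr1).
  by rewrite -mulr_suml w1 mul1r.
apply: le_trans (lobatto_convex_ge hgl w0 _); last first.
  by move=> q b; apply: psi_ge0; have [] := hnodes i j b q.
by rewrite /trace2p subrK gl0 gl1 ypt_1 ypt_N1.
Qed.

Lemma scheme_step_ge i j : face_pairs i j <= psi (scheme_step mix M g alpha1 alpha2 dt U i j).
Proof.
have a1 := alpha1_gt0; have a2 := alpha2_gt0.
have s1 : 0 < dt / dx M by rewrite divr_gt0.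
have s2 : 0 < dt / dy M by rewrite divr_gt0.
have lam0 : 0 < dt / dx M * alpha1 + dt / dy M * alpha2 by rewrite addr_gt0// mulr_gt0.
have [Q0 _ _ _] := hg.
have [eps [CFL J1 J2]] := epsilon_bound Q0 a1 a2 lam0 hCFL.
have r0 (u : state R n) : 0 <= Num.sqrt (rho u) by exact: sqrtr_ge0.
have D1 := @direction_bound R _ psi (fun u => dotv (flux mix dir1 u) e)
  (fun u => dotv (source u) e) (B_comp dir1) (fun u => Num.sqrt (rho u)) alpha1 k Q (weight g)
  (trace1m M g U i j) (trace1p M g U i j) (trace1m M g U (i - 1) j) (trace1p M g U (i - 1) j)
  (dt / dx M) eps (ltW s1) w0 r0
  (fun q => psi_ge0 (G_trace1m i j q)) (fun q => psi_ge0 (G_trace1p (i - 1) j q))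
  (fun q => psi_source (G_trace1m i j q)) (fun q => psi_source (G_trace1p (i - 1) j q))
  (fun q => J1 i j q _ (or_introl erefl)) (fun q => J1 (i - 1) j q _ (or_intror erefl)).
have D2 := @direction_bound R _ psi (fun u => dotv (flux mix dir2 u) e)
  (fun u => dotv (source u) e) (B_comp dir2) (fun u => Num.sqrt (rho u)) alpha2 k Q (weight g)
  (trace2m M g U i j) (trace2p M g U i j) (trace2m M g U i (j - 1)) (trace2p M g U i (j - 1))
  (dt / dy M) eps (ltW s2) w0 r0
  (fun q => psi_ge0 (G_trace2m i j q)) (fun q => psi_ge0 (G_trace2p i (j - 1) q))
  (fun q => psi_source (G_trace2m i j q)) (fun q => psi_source (G_trace2p i (j - 1) q))
  (fun q => J2 i j q _ (or_introl erefl)) (fun q => J2 i (j - 1) q _ (or_intror erefl)).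
have A1 := average_ge1 i j; have A2 := average_ge2 i j.
have div0 := hdiv i j.
apply: (le_trans _ (le_trans (lerD (lerD (lexx (psi (cell_average M i j (U i j)))) D1) D2) _));
  last first.
{ rewrite le_eqVlt; apply/orP; left; apply/eqP/esym.
  rewrite /psi /scheme_step /num_source; apply: dotv_update.
  all: rewrite ?/num_flux1 ?/num_flux2 dotv_wsum; apply: eq_bigr => q _; congr (_ * _).
  1-4: exact: dotv_flux_LF.
  all: apply: etrans (dotvDl _ _ _) _.
  all: refine (f_equal2 _ _ _).
  all: exact: dotvZl. }
apply: (cfl_absorb _ _ _ (mulr_gt0 s1 a1) (mulr_gt0 s2 a2) _ _ A1 A2 CFL).
- by apply: sumr_ge0 => q _; rewrite mulr_ge0// addr_ge0// psi_ge0//; [exact: G_trace1m|exact: G_trace1p].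
- by apply: sumr_ge0 => q _; rewrite mulr_ge0// addr_ge0// psi_ge0//; [exact: G_trace2m|exact: G_trace2p].
- rewrite -!mulrA -mulrDr; move: div0; rewrite /div_minus => ->; exact: mulr0.
Qed.
End functional.

Lemma face_pairs_ge0 (e : state R n) (c k : R) i j :
  (forall l a u u', G mix u -> G mix u' -> alpha_hat mix l u u' <= a ->
    0 <= pair_term (fun u => dotv u e + c) (fun u => dotv (flux mix l u) e) (B_comp l) a k u u') ->
  0 <= face_pairs e c k i j.
Proof.
move=> hp; rewrite /face_pairs addr_ge0// mulr_ge0 ?divr_ge0 ?(ltW hdt) ?(ltW hdx) ?(ltW hdy)//.
- apply: sumr_ge0 => q _; rewrite mulr_ge0 ?gauss_weight_ge0// addr_ge0//; apply: hp.
  + exact: G_trace1p.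
  + exact: G_trace1m.
  + by have [] := halpha1 i j q.
  + exact: G_trace1m.
  + exact: G_trace1p.
  + by have [] := halpha1 i j q.
- apply: sumr_ge0 => q _; rewrite mulr_ge0 ?gauss_weight_ge0// addr_ge0//; apply: hp.
  + exact: G_trace2p.
  + exact: G_trace2m.
  + by have [] := halpha2 i j q.
  + exact: G_trace2m.
  + exact: G_trace2p.
  + by have [] := halpha2 i j q.
Qed.

Lemma face_pairs_gt0 (e : state R n) (c k : R) i j :
  (forall l a u u', G mix u -> G mix u' -> alpha_hat mix l u u' <= a ->
    0 < pair_term (fun u => dotv u e + c) (fun u => dotv (flux mix l u) e) (B_comp l) a k u u') ->
  0 < face_pairs e c k i j.
Proof.
have w1 := quad_weights_sum1 hgK.
have w0 q : 0 <= weight g q by exact: gauss_weight_ge0.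
move=> hp; rewrite /face_pairs; apply: addr_gt0; apply: mulr_gt0; rewrite ?divr_gt0//.
- apply: weighted_sum_gt0 => // q; apply: addr_gt0; apply: hp.
  + exact: G_trace1p.
  + exact: G_trace1m.
  + by have [] := halpha1 i j q.
  + exact: G_trace1m.
  + exact: G_trace1p.
  + by have [] := halpha1 i j q.
- apply: weighted_sum_gt0 => // q; apply: addr_gt0; apply: hp.
  + exact: G_trace2p.
  + exact: G_trace2m.
  + by have [] := halpha2 i j q.
  + exact: G_trace2m.
  + exact: G_trace2p.
  + by have [] := halpha2 i j q.
Qed.

Lemma scheme_step_phi_gt0 vs Bs i j :
  0 < phi (scheme_step mix M g alpha1 alpha2 dt U i j) vs Bs.
Proof.
apply: lt_le_trans (scheme_step_ge (e := nstar n vs Bs) (k := dotv vs Bs) _ _ i j).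
- apply: face_pairs_gt0 => l a u u' Gu Gu' ha; exact: flux_pair_gt0.
- by move=> u Gu; apply: ltW; exact: phi_gt0 Gu.
- by move=> u Gu; exact: source_le Gu.
Qed.

(** Functionals that are merely transported, such as the partial densities: a pair contributes
    (a - v_l) psi(u) + (a + v'_l) psi(u'), where both velocities are below a in absolute value. *)
Section advected.
Variable e : state R n.
Hypothesis flux_e : forall l u, dotv (flux mix l u) e = vel u ord0 l * dotv u e.
Hypothesis source_e : forall u, dotv (source u) e = 0.

Let pairE l a u u' :
  pair_term (fun u => dotv u e + 0) (fun u => dotv (flux mix l u) e) (B_comp l) a 0 u u' =
  (a - vel u ord0 l) * dotv u e + (a + vel u' ord0 l) * dotv u' e.
Proof. by rewrite /pair_term !flux_e; ring. Qed.

Let scheme_ge i j : (forall u, G mix u -> 0 <= dotv u e) ->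
  face_pairs e 0 0 i j <= dotv (scheme_step mix M g alpha1 alpha2 dt U i j) e.
Proof.
move=> e0; rewrite -[leRHS]addr0; apply: scheme_step_ge => u Gu.
  by rewrite addr0 e0.
by rewrite source_e !addr0 normr0 divr_ge0 ?sqrtr_ge0 ?e0.
Qed.

Lemma scheme_step_advected_ge0 i j : (forall u, G mix u -> 0 <= dotv u e) ->
  0 <= dotv (scheme_step mix M g alpha1 alpha2 dt U i j) e.
Proof.
move=> e0; apply: le_trans (scheme_ge i j e0); apply: face_pairs_ge0 => l a u u' Gu Gu' ha.
have [] := normr_vel_lt_alpha hCv hGam Gu Gu' ha; rewrite !ltr_norml => /andP[_ h] /andP[h' _].
rewrite pairE; apply: addr_ge0; apply: mulr_ge0; rewrite ?e0//.
  by rewrite subr_ge0 ltW.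
by rewrite -lerBlDl sub0r ltW.
Qed.

Lemma scheme_step_advected_gt0 i j : (forall u, G mix u -> 0 < dotv u e) ->
  0 < dotv (scheme_step mix M g alpha1 alpha2 dt U i j) e.
Proof.
move=> e0; apply: lt_le_trans (scheme_ge i j _); last by move=> u /e0/ltW.
apply: face_pairs_gt0 => l a u u' Gu Gu' ha.
have [] := normr_vel_lt_alpha hCv hGam Gu Gu' ha; rewrite !ltr_norml => /andP[_ h] /andP[h' _].
rewrite pairE; apply: addr_gt0; apply: mulr_gt0; rewrite ?e0//.
  by rewrite subr_gt0.
by rewrite -ltrBlDl sub0r.
Qed.
End advected.
End scheme.

Lemma dotv_evec_rho (R : realType) (n : nat) (u : state R n) : dotv u (evec_rho R n) = rho u.
Proof. by rewrite dotv_mk_state !dotv0r; ring. Qed.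

Lemma dotv_evec (R : realType) (n : nat) (u : state R n) k :
  dotv u (evec R k) = mass_frac_part u ord0 k.
Proof. by rewrite dotv_mk_state !dotv0r dotv_delta; ring. Qed.

Lemma dotv_evec0 (R : realType) (n : nat) (u : state R n) :
  dotv u (evec0 R n) = rho u - \sum_k mass_frac_part u ord0 k.
Proof.
rewrite dotvC /evec0 dotvBl dotv_suml dotvC dotv_evec_rho; congr (_ - _).
by apply: eq_bigr => k _; rewrite dotvC dotv_evec.
Qed.

Unset Implicit Arguments.
Set Strict Implicit.

Theorem theorem6p4 (R : realType) (n : nat) (mix : mixture R n)
  (hCv : forall k, 0 < heat_cap mix k) (hGam : forall k, 1 < adiab mix k)
  (M : mesh R) (hdx : 0 < dx M) (hdy : 0 < dy M) (dt : R) (hdt : 0 < dt)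
  (K : nat) (hK : (1 <= K)%N)
  (Q : nat) (g : quad_rule R Q) (hg : is_gauss g) (hgK : quad_exact g K)
  (N : nat) (hN : N.+2 = uphalf (K + 3)%N)
  (gl : quad_rule R N.+2) (hgl : is_gauss_lobatto gl)
  (U : solution R n) (hdeg : forall i j k, degree_le K (U i j ord0 k))
  (alpha1 alpha2 : R)
  (halpha1 : alpha1_ok mix M g U alpha1) (halpha2 : alpha2_ok mix M g U alpha2)
  (havg : forall i j, G mix (cell_average M i j (U i j)))
  (hnodes : forall i j (b : 'I_N.+2) (q : 'I_Q),
     G mix (eval_state (U i j) (xpt M i (node gl b)) (ypt M j (node g q))) /\
     G mix (eval_state (U i j) (xpt M i (node g q)) (ypt M j (node gl b))))
  (hdiv : forall i j, div_minus M g U i j = 0)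
  (hCFL : ((1 + epsilon M g U alpha1 alpha2) *
           (dt / dx M * alpha1 + dt / dy M * alpha2)%:E
             <= (weight gl ord0)%:E)%E) :
  forall i j, Gstar (scheme_step mix M g alpha1 alpha2 dt U i j).
Proof.
(* With L = ceil((K + 3) / 2) nodes the degree of exactness 2L - 3 is at least K. *)
have hglK : quad_exact gl K.
  by have [_ _ _ _] := hgl; apply: quad_exact_le; lia.
have flux_rho l (u : state R n) : dotv (flux mix l u) (evec_rho R n) =
    vel u ord0 l * dotv u (evec_rho R n).
  by rewrite !dotv_evec_rho rho_mk_state mulrC.
have flux_Y k l (u : state R n) : dotv (flux mix l u) (evec R k) =
    vel u ord0 l * dotv u (evec R k).
  by rewrite !dotv_evec mass_frac_mk_state mxE.
move=> i j; split.
- apply: (scheme_step_advected_ge0 hCv hGam hdx hdy hdt hg hgK hgl hglK) => //.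
  + move=> l u; rewrite !dotv_evec0 mulrBr; congr (_ - _).
      by have := flux_rho l u; rewrite !dotv_evec_rho.
    rewrite mulr_sumr; apply: eq_bigr => k _.
    by have := flux_Y k l u; rewrite !dotv_evec.
  + move=> u; rewrite dotv_evec0 rho_mk_state mass_frac_mk_state big1 ?subr0// => k _.
    by rewrite mxE.
  + move=> u Gu; have r0 := G_rho_gt0 Gu.
    have [hY _] := Gu; have /andP[+ _] := hY ord_max.
    by rewrite Y_ord_max -mulr_suml dotv_evec0 !subr_ge0 ler_pdivrMr// mul1r.
- move=> k; apply: (scheme_step_advected_ge0 hCv hGam hdx hdy hdt hg hgK hgl hglK) => //.
  + by move=> u; rewrite dotv_evec mass_frac_mk_state mxE.
  + move=> u Gu; have r0 := G_rho_gt0 Gu.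
    have [hY _] := Gu; have /andP[+ _] := hY (widen_ord (leqnSn n) k).
    by rewrite Y_widen dotv_evec pmulr_lge0// invr_gt0.
- apply: (scheme_step_advected_gt0 hCv hGam hdx hdy hdt hg hgK hgl hglK) => //.
  + by move=> u; rewrite dotv_evec_rho rho_mk_state.
  + by move=> u Gu; rewrite dotv_evec_rho (G_rho_gt0 Gu).
- by move=> vs Bs; apply: (scheme_step_phi_gt0 hCv hGam hdx hdy hdt hg hgK hgl hglK).
Qed.
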